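(* Let $(\Gamma,\mu,v_0)$ be a vertex-weighted pointed graph satisfying the standing assumptions in the context. For all $m,n,k\in\mathbb N$ (including $0$) and every $x\in W_k$, acting on $\mathcal H_0=L^2(\mathcal S_0,\mathrm{tr}_0)$ by left multiplication, $$\|P_m\,x\,P_n\|\le\|x\|_2,$$ where the left side is the operator norm and $\|x\|_2=\mathrm{tr}_0(x^*x)^{1/2}$.
   Context: Graphs. $\Gamma=(V,E)$ is a countable, connected, locally finite, undirected graph (loops and multiple edges allowed) with a weighting $\mu:V\to(0,\infty)$. The directed graph $\vec\Gamma=(V,\vec E,s,t)$ has, for each $e\in E$ with distinct endpoints $\alpha\ne\beta$, two edges $\epsilon,\epsilon^{\rm op}$ with $s(\epsilon)=t(\epsilon^{\rm op})=\alpha$, $t(\epsilon)=s(\epsilon^{\rm op})=\beta$, and for each loop $e\in E$ at a vertex $\gamma$ a single edge $\epsilon=\epsilon^{\rm op}$ with $s(\epsilon)=t(\epsilon)=\gamma$. A base point $v_0\in V$ is fixed. Standing assumptions: $\mu(v_0)=1$ and $\mu(v_0)\le\mu(v)$ for all $v\in V$; and $\mu(v)<\sum_{\epsilon\in\vec E,\,s(\epsilon)=v}\mu(t(\epsilon))$ for all $v\in V$. Free graph algebra. $C_0(V)$ is generated by the indicator functions $p_v$, $v\in V$. $\mathcal X$ is the Hilbert $C_0(V)$-bimodule completing the finite linear combinations of edges in $\vec E$, with $\langle\epsilon,\epsilon'\rangle=\delta_{\epsilon,\epsilon'}p_{t(\epsilon)}$, $p_\alpha\epsilon=\delta_{\alpha,s(\epsilon)}\epsilon$,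 $\epsilon p_\beta=\delta_{\beta,t(\epsilon)}\epsilon$. On the Fock space $\mathcal F(\vec\Gamma)=C_0(V)\oplus\bigoplus_{n\ge1}\mathcal X^{\otimes_{C_0(V)}n}$ (whose $n$-th summand is spanned by $\epsilon_1\otimes\cdots\otimes\epsilon_n$ with $\epsilon_1\cdots\epsilon_n$ a path) the creation operator is $\ell(\epsilon)(\epsilon_1\otimes\cdots\otimes\epsilon_n)=\epsilon\otimes\epsilon_1\otimes\cdots\otimes\epsilon_n$, $\ell(\epsilon)p_v=\delta_{v,t(\epsilon)}\epsilon$, with adjoint $\ell(\epsilon)^*(\epsilon_1\otimes\cdots\otimes\epsilon_n)=\langle\epsilon,\epsilon_1\rangle\epsilon_2\otimes\cdots\otimes\epsilon_n$, $\ell(\epsilon)^*p_v=0$. Put $a_\epsilon=(\mu(s(\epsilon))/\mu(t(\epsilon)))^{1/4}$ and $X_\epsilon=a_\epsilon\ell(\epsilon)+a_\epsilon^{-1}\ell(\epsilon^{\rm op})^*$. The free graph algebra $\mathcal S(\Gamma,\mu)$ is the $\mathrm C^*$-algebra generated by $C_0(V)$ and all $X_\epsilon$, $\epsilon\in\vec E$. It carries a faithful semifinite trace $\mathrm{Tr}=\mu\circ\mathbb E$, where $\mathbb E(x)=\sum_v\langle p_v, xp_v\rangle_{C_0(V)}$; $\mathrm{Tr}(p_v)=\mu(v)$. Free loop algebra. $\mathcal S_0:=p_{v_0}\mathcal S(\Gamma,\mu)p_{v_0}$, with faithful tracial state $\mathrm{tr}_0=\mathrm{Tr}|_{\mathcal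 S_0}$ and GNS space $\mathcal H_0=L^2(\mathcal S_0,\mathrm{tr}_0)$. For a path $\sigma=\epsilon_1\cdots\epsilon_n$ in $\vec\Gamma$ put $|\sigma|=n$, $\sigma^{\rm op}=\epsilon_n^{\rm op}\cdots\epsilon_1^{\rm op}$, $\ell(\sigma)=\ell(\epsilon_1)\cdots\ell(\epsilon_n)$, $a_\sigma=(\mu(s(\epsilon_1))/\mu(t(\epsilon_n)))^{1/4}$; for a path of length $0$ at $v$, $\ell(v)=p_v$ and $a_v=1$. The Wick word is $Y_\sigma=\sum_{\sigma=\rho\tau}a_\rho a_\tau^{-1}\ell(\rho)\ell(\tau^{\rm op})^*$ (sum over all factorizations, $\rho$ or $\tau$ possibly of length $0$); it lies in $\mathcal S(\Gamma,\mu)$. Let $\Pi_0$ be the set of loops in $\vec\Gamma$ based at $v_0$ (including length $0$). The elements $Y_\sigma$, $\sigma\in\Pi_0$, lie in $\mathcal S_0$ and form an orthonormal basis of $\mathcal H_0$. Finally $W_n=\mathrm{span}\{Y_\sigma:\sigma\in\Pi_0,\ |\sigma|=n\}$ (finite dimensional) and $P_n$ is the orthogonal projection of $\mathcal H_0$ onto $W_n$. *)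

(* Defs.v *)
From HB Require Import structures.
From mathcomp Require Import all_boot all_order all_algebra.
From mathcomp Require Import sesquilinear complex ring.
From mathcomp Require Import all_classical all_reals all_analysis.

Set Implicit Arguments.
Unset Strict Implicit.
Unset Printing Implicit Defensive.

Import Order.TTheory GRing.Theory Num.Theory.
Import numFieldNormedType.Exports.

Local Open Scope classical_set_scope.
Local Open Scope ring_scope.
Local Open Scope complex_scope.

(* Each undirected edge [e] carries an arbitrary ordering of its two end
   points; it is only used to name the two orientations of [e]. *)
Record wgraph (R : realType) := WGraph {
  vertex : countType;
  edge : countType;
  ends : edge -> vertex * vertex;
  mu : vertex -> R;
  mu_gt0 : forall v, 0 < mu v;
  base : vertex
}.

Section Graph.
Context {R : realType} (G : wgraph R).
Implicit Types (v w : vertex G).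

Definition is_loop (e : edge G) : bool := (ends e).1 == (ends e).2.

(* [(e, false)] runs from [(ends e).1] to [(ends e).2]; the reversed
   [(e, true)] exists only when [e] is not a loop. *)
Definition dedge := {d : edge G * bool | d.2 ==> ~~ is_loop d.1}.
HB.instance Definition _ := Countable.on dedge.

Definition dsrc (d : dedge) : vertex G :=
  if (val d).2 then (ends (val d).1).2 else (ends (val d).1).1.

Definition dtgt (d : dedge) : vertex G :=
  if (val d).2 then (ends (val d).1).1 else (ends (val d).1).2.

Fact dop_subproof (d : dedge) :
  let e := (val d).1 in (~~ (val d).2 && ~~ is_loop e) ==> ~~ is_loop e.
Proof. by apply/implyP => /andP[]. Qed.

Definition dop (d : dedge) : dedge :=
  Sub ((val d).1, ~~ (val d).2 && ~~ is_loop (val d).1) (dop_subproof d).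

Fixpoint is_walk v (s : seq dedge) : bool :=
  if s is d :: s' then (dsrc d == v) && is_walk (dtgt d) s' else true.

(* [(v, s)] is the path with edges [s] starting at [v], and [(v, [::])] is
   the path of length 0 at [v]. *)
Definition rpath := (vertex G * seq dedge)%type.

Definition src (p : rpath) : vertex G := p.1.
Definition tgt (p : rpath) : vertex G := last p.1 (map dtgt p.2).
Definition len (p : rpath) : nat := size p.2.
Definition rpath_op (p : rpath) : rpath := (tgt p, rev (map dop p.2)).

Definition gpath := {p : rpath | is_walk p.1 p.2}.
HB.instance Definition _ := Countable.on gpath.

Definition locally_finite : Prop := forall v,
  finite_set [set e : edge G | (ends e).1 = v \/ (ends e).2 = v].

Definition connected_graph : Prop := forall v w,
  exists2 p : gpath, src (val p) = v & tgt (val p) = w.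

Definition standing_assumptions : Prop :=
  [/\ locally_finite, connected_graph,
      mu (base G) = 1, (forall v, mu (base G) <= mu v)
    & forall v, mu v < \sum_(d \in [set d : dedge | dsrc d = v]) mu (dtgt d)].

End Graph.

Definition rsum {R : realType} {T : choiceType} (A : set T) (f : T -> R) : R :=
  fine (\esum_(i in A) (EFin \o f)^\+%E i) -
  fine (\esum_(i in A) (EFin \o f)^\-%E i).

(* Meant for absolutely summable families only. *)
Definition csum {R : realType} {T : choiceType} (A : set T) (f : T -> R[i]) :
    R[i] :=
  (rsum A (fun i => complex.Re (f i))) +i* (rsum A (fun i => complex.Im (f i))).

Definition opnorm {R : realType} {U V : Type} (nU : U -> R) (nV : V -> R)
    (T : U -> V) : \bar R :=
  ereal_sup [set (nV (T x))%:E | x in [set x | nU x <= 1]].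

Definition lspan {K : nzRingType} {U : lmodType K} (A : set U) : set U :=
  [set x | exists n (c : 'I_n -> K) (u : 'I_n -> U),
    (forall i, A (u i)) /\ x = \sum_(i < n) c i *: u i].

Section Vanishing.
Context {R : realType} {T : Type}.

Definition vanishing (a : T -> R[i]) : Prop :=
  forall e : R, 0 < e -> finite_set [set v | e <= Normc.normc (a v)].

Lemma vanishing_bounded (a : T -> R[i]) : vanishing a ->
  exists2 K : R, 0 <= K & forall v, Normc.normc (a v) <= K.
Proof.
move=> /(_ 1 ltr01) /(finite_image (fun v => Normc.normc (a v))).
move=> /finite_seqP[s sE]; exists (1 + \sum_(x <- s) `|x|).
  by rewrite addr_ge0 ?sumr_ge0.
move=> v; have [a1|/ltW a1] := leP 1 (Normc.normc (a v)); last first.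
  by rewrite (le_trans a1)// lerDl sumr_ge0.
have vs : Normc.normc (a v) \in s.
  suff : [set` s] (Normc.normc (a v)) by [].
  by rewrite -sE; exists v.
rewrite (big_rem _ vs)/= (le_trans (ler_norm _))// addrCA lerDl.
by rewrite addr_ge0 ?sumr_ge0.
Qed.

(* The nonnegative elements of [C_0(T)], as extended real functions. *)
Definition vanishing_fin (h : T -> \bar R) : Prop :=
  (forall v, h v \is a fin_num) /\ vanishing (fun v => (fine (h v))%:C).

Lemma vanishing_finP (h : T -> \bar R) : (forall v, 0 <= h v)%E ->
  vanishing_fin h <-> (forall v, h v \is a fin_num) /\
    forall e : R, 0 < e -> finite_set [set v | (e%:E <= h v)%E].
Proof.
move=> h0; suff eqs : (forall v, h v \is a fin_num) -> forall e : R,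
    [set v | e <= Normc.normc (fine (h v))%:C] = [set v | (e%:E <= h v)%E].
  split=> -[hf hv]; split=> // e e0; last by rewrite /= eqs//; exact: hv.
  by rewrite -eqs//; exact: hv.
move=> hf e; apply/seteqP; split=> v /=;
  by rewrite expr0n addr0 sqrtr_sqr ger0_norm ?fine_ge0// -lee_fin fineK.
Qed.

Lemma vanishing_fin_le (k : R) (g h : T -> \bar R) : 0 <= k ->
    (forall v, 0 <= g v)%E -> (forall v, 0 <= h v)%E ->
    (forall v, g v <= k%:E * h v)%E ->
  vanishing_fin h -> vanishing_fin g.
Proof.
move=> k0 g0 h0 gh /(vanishing_finP h0)[hf hv].
apply/vanishing_finP => //; split=> [v|e e0].
  rewrite ge0_fin_numE//; apply: (le_lt_trans (gh v)).
  by rewrite -(fineK (hf v)) -EFinM ltry.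
have k1 : 0 < k + 1 by rewrite ltr_wpDl.
apply: sub_finite_set (hv (e / (k + 1)) _); last by rewrite divr_gt0.
move=> v /= ev; have := le_trans ev (gh v).
rewrite -(fineK (hf v)) -EFinM !lee_fin => ekh.
rewrite ler_pdivrMr// mulrDr mulr1 mulrC (le_trans ekh)// lerDl.
exact: fine_ge0.
Qed.

Lemma vanishing_finD (g h : T -> \bar R) :
    (forall v, 0 <= g v)%E -> (forall v, 0 <= h v)%E ->
  vanishing_fin g -> vanishing_fin h -> vanishing_fin (g \+ h)%E.
Proof.
move=> g0 h0 /(vanishing_finP g0)[gf gv] /(vanishing_finP h0)[hf hv].
apply/vanishing_finP => [v|]; first by rewrite adde_ge0.
split=> [v|e e0]; first by rewrite fin_numD gf hf.
have e2 : 0 < e / 2 by rewrite divr_gt0.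
have : finite_set ([set v | ((e / 2)%:E <= g v)%E] `|`
                   [set v | ((e / 2)%:E <= h v)%E]).
  by rewrite finite_setU; split; [exact: gv|exact: hv].
apply: sub_finite_set => v /= egh.
have [eg|ge] := leP (e / 2)%:E (g v); first by left.
right; rewrite leNgt; apply/negP => he.
by have := lteD ge he; rewrite -EFinD -splitr ltNge egh.
Qed.

End Vanishing.

Section Fock.
Context {R : realType} (G : wgraph R).
Local Notation C := R[i].
Implicit Types (v : vertex G) (d : dedge G) (p : gpath G) (f : gpath G -> C).

Record c0 := C0 { c0val :> vertex G -> C; c0P : vanishing c0val }.

(* [<f, f>(v)] for a formal combination [f] of paths. *)
Definition sqnorm_at f v : \bar R :=
  \esum_(p in [set p | tgt (val p) = v]) (Normc.normc (f p) ^+ 2)%:E.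

(* Families of coordinates in the basis of paths.  The completion of the
   finite combinations of paths for the norm [sup_v <f, f>(v) ^ (1/2)] consists
   of the families [f] such that [<f, f>] is finite and belongs to [C_0(V)]. *)
Definition in_fock : {pred gpath G -> C} :=
  fun f => `[< vanishing_fin (sqnorm_at f) >].

Lemma sqnorm_at_ge0 f v : (0 <= sqnorm_at f v)%E.
Proof. by apply: esum_ge0 => p _; rewrite lee_fin sqr_ge0. Qed.

Lemma in_fockP f :
  reflect (vanishing_fin (sqnorm_at f)) (f \in in_fock).
Proof. exact: asboolP. Qed.

Lemma sqnorm_at_leZ f g v (k : R) : 0 <= k ->
    (forall p, tgt (val p) = v ->
      Normc.normc (f p) ^+ 2 <= k * Normc.normc (g p) ^+ 2) ->
  (sqnorm_at f v <= k%:E * sqnorm_at g v)%E.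
Proof.
move=> k0 fg; apply: ge_ereal_sup => _ [A [finA sA] <-].
apply: (@le_trans _ _
  (k%:E * \sum_(p \in A) (Normc.normc (g p) ^+ 2)%:E)%E).
  rewrite ge0_mule_fsumr => [|p]; last by rewrite lee_fin sqr_ge0.
  by apply: lee_fsum => // p /sA pv; rewrite -EFinM lee_fin; exact: fg.
rewrite lee_wpmul2l//; apply: ereal_sup_ubound; exists A => //.
Qed.

Lemma in_fock_submod_closed : submod_closed in_fock.
Proof.
have fockD f g : f \in in_fock -> g \in in_fock -> f + g \in in_fock.
  move=> /in_fockP ff /in_fockP gg; apply/in_fockP.
  apply: (@vanishing_fin_le _ _ 2 _ (sqnorm_at f \+ sqnorm_at g)%E);
    [by [] | exact: sqnorm_at_ge0 | by move=> v; rewrite adde_ge0 ?sqnorm_at_ge0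
    | | by apply: vanishing_finD => //; exact: sqnorm_at_ge0].
  move=> v; rewrite /= -esumD; try by move=> p _; rewrite lee_fin sqr_ge0.
  apply: ge_ereal_sup => _ [A [finA sA] <-].
  apply: (@le_trans _ _ (2%:E * \sum_(p \in A)
    ((Normc.normc (f p) ^+ 2)%:E + (Normc.normc (g p) ^+ 2)%:E))%E).
    rewrite ge0_mule_fsumr => [|p]; last by rewrite adde_ge0// lee_fin sqr_ge0.
    apply: lee_fsum => // p _; rewrite -EFinD -EFinM lee_fin.
    apply: (@le_trans _ _ ((Normc.normc (f p) + Normc.normc (g p)) ^+ 2)).
      have ge0 z : 0 <= Normc.normc z :> R by case: z => ? ?; exact: sqrtr_ge0.
      by rewrite ler_sqr ?nnegrE ?addr_ge0 ?ge0//; exact: le_normcD.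
    rewrite -subr_ge0; set a := Normc.normc _; set b := Normc.normc _.
    by rewrite (_ : _ - _ = (a - b) ^+ 2) ?sqr_ge0//; ring.
  rewrite lee_wpmul2l//; apply: ereal_sup_ubound; exists A => //.
split.
  apply/in_fockP/vanishing_finP; first exact: sqnorm_at_ge0.
  have s0 v : sqnorm_at 0 v = 0%E.
    apply: esum1 => p _; rewrite (_ : Normc.normc _ = 0) ?expr0n//.
    exact: Normc.normc0.
  split=> [v|e e0]; first by rewrite s0.
  rewrite (_ : [set _ | _] = set0) ?finite_set0//.
  by apply/seteqP; split=> v //=; rewrite s0 lee_fin leNgt e0.
move=> c f g ff gg; apply: fockD => //.
move/in_fockP: ff => ff; apply/in_fockP.
have k0 := sqr_ge0 (Normc.normc c).
apply: (vanishing_fin_le k0 (sqnorm_at_ge0 _) (sqnorm_at_ge0 _) _ ff) => v.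
by apply: sqnorm_at_leZ => // p _; rewrite /= Normc.normcM exprMn.
Qed.

HB.instance Definition _ := GRing.isSubmodClosed.Build _ _ in_fock
  in_fock_submod_closed.

Record fock := Fock { fockval :> gpath G -> C; fockP : fockval \in in_fock }.

HB.instance Definition _ := [isSub for fockval].
HB.instance Definition _ := [Choice of fock by <:].
HB.instance Definition _ := [SubChoice_isSubLmodule of fock by <:].

(* The [C_0(V)]-valued inner product, linear in the second variable. *)
Definition ip (f g : fock) v : C :=
  csum [set p | tgt (val p) = v] (fun p => (f p)^* * g p).

Definition fnorm (f : fock) : R :=
  Num.sqrt (sup (range (fun v => Normc.normc (ip f f v)))).

Fact lact_subproof (a : c0) (f : fock) :
  (fun p => a (src (val p)) * f p) \in in_fock.
Proof.
have [K K0 aK] := vanishing_bounded (c0P a).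
apply/in_fockP; have /in_fockP := fockP f.
apply: (vanishing_fin_le (sqr_ge0 K)); try exact: sqnorm_at_ge0.
move=> v; apply: sqnorm_at_leZ => [|p _]; first exact: sqr_ge0.
rewrite Normc.normcM exprMn ler_wpM2r ?sqr_ge0// ler_sqr ?nnegrE//.
by case: (a _) => ? ?; exact: sqrtr_ge0.
Qed.

(* The left action of [C_0(V)]. *)
Definition lact (a : c0) (f : fock) : fock := Fock (lact_subproof a f).

Fact c0_ind_subproof v : vanishing (fun w => (w == v)%:R : C).
Proof.
move=> e e0; apply: (@sub_finite_set _ _ [set v]); last exact: finite_set1.
move=> w /=; case: eqVneq => // _; rewrite (_ : Normc.normc _ = 0).
  by rewrite leNgt e0.
exact: Normc.normc0.
Qed.

Definition c0_ind v : c0 := C0 (c0_ind_subproof v).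

(* [p_v], as an operator and as a vector. *)
Definition pv v : fock -> fock := lact (c0_ind v).

Fact pvec_subproof v : (fun p => (val p == (v, [::]))%:R : C) \in in_fock.
Proof.
set f := (fun p => _); apply/in_fockP/vanishing_finP.
  exact: sqnorm_at_ge0.
pose p0 : gpath G := exist _ (v, [::]) isT.
have fE p : Normc.normc (f p) ^+ 2 = (p == p0)%:R.
  rewrite /f -[val p == _]/(p == p0); case: eqP => _.
    by rewrite (_ : Normc.normc _ = 1) ?expr1n//; exact: Normc.normc1.
  by rewrite (_ : Normc.normc _ = 0) ?expr0n//; exact: Normc.normc0.
have f0 w : w != v -> sqnorm_at f w = 0%E.
  move=> wv; apply: esum1 => p /= pw; rewrite fE; case: eqP => // pp0.
  by move: wv; rewrite -pw pp0 /= eqxx.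
have f1 : sqnorm_at f v = 1%E.
  rewrite /sqnorm_at (eq_esum (b := fun p => if p \in [set p0] then 1%E else 0%E)).
    rewrite -esum_mkcondr setIidr ?esum_set1// => p ->/=.
    by [].
  by move=> p _; rewrite fE; case: eqP => pp; [rewrite mem_set|rewrite memNset].
split=> [w|e e0]; first by have [->|/f0->] := eqVneq w v; rewrite ?f1.
apply: (@sub_finite_set _ _ [set v]); last exact: finite_set1.
move=> w /=; have [//|/f0->] := eqVneq w v.
by rewrite lee_fin leNgt e0.
Qed.

Definition pvec v : fock := Fock (pvec_subproof v).

Definition rpath_behead (q : rpath G) : rpath G :=
  if q.2 is d :: s then (dtgt d, s) else q.

Fact gpath_behead_subproof p :
  is_walk (rpath_behead (val p)).1 (rpath_behead (val p)).2.
Proof. by case: p => -[v [|d s]] //= /andP[]. Qed.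

Definition gpath_behead p : gpath G :=
  exist _ (rpath_behead (val p)) (gpath_behead_subproof p).

Fact creation_subproof d (f : fock) :
  (fun p => if ohead (val p).2 == Some d then f (gpath_behead p) else 0)
    \in in_fock.
Proof.
set g := (fun p => _); apply/in_fockP; have /in_fockP := fockP f.
apply: (@vanishing_fin_le _ _ 1 _ (sqnorm_at f)); try exact: sqnorm_at_ge0.
  by [].
move=> v; rewrite mul1e.
pose S := [set p : gpath G | tgt (val p) = v].
pose D := [set p : gpath G | ohead (val p).2 == Some d].
have -> : sqnorm_at g v =
    \esum_(p in S `&` D) (Normc.normc (f (gpath_behead p)) ^+ 2)%:E.
  rewrite esum_mkcondr; apply: eq_esum => p _; rewrite /g.
  have [pd|pd] := boolP (_ == _); first by rewrite mem_set.
  rewrite memNset//; last exact/negP.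
  by rewrite (_ : Normc.normc _ = 0) ?expr0n//; exact: Normc.normc0.
rewrite -(@esum_image _ _ _ _ gpath_behead
  (fun p => (Normc.normc (f p) ^+ 2)%:E)).
  apply: ereal_sup_le => _ [A [finA sA] <-]; exists A => //; split=> // p /sA.
  case=> -[[w [|d' s]] pw] [/= pv /eqP] //= [dd'] <- /=.
  by rewrite -pv.
move=> p1 p2 /set_mem[_ /= /eqP D1] /set_mem[_ /= /eqP D2] /(congr1 val) /=.
case: p1 p2 D1 D2 => -[v1 [|d1 s1]] w1 [[v2 [|d2 s2]] w2] //= [e1] [e2] [_ es].
have /= /andP[/eqP v1E _] := w1; have /= /andP[/eqP v2E _] := w2.
by apply/val_inj; rewrite /= -v1E -v2E e1 e2 es.
Qed.

(* [l(d)]: the coordinate of [l(d) f] at the path [d q] is that of [f] at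
   [q]. *)
Definition creation d (f : fock) : fock := Fock (creation_subproof d f).

Definition is_adjoint (T T' : fock -> fock) : Prop :=
  forall (f g : fock) v, ip (T f) g v = ip f (T' g) v.

Definition adjointable (T : fock -> fock) : Prop := exists T', is_adjoint T T'.

(* The adjoint of an adjointable operator, and [0] for the others. *)
Definition adj (T : fock -> fock) : fock -> fock :=
  xget (fun=> 0) [set T' | is_adjoint T T'].

Definition is_cstar_subalgebra (B : set (fock -> fock)) : Prop :=
  [/\ B `<=` adjointable, B (fun=> 0),
      (forall (c : C) S T, B S -> B T -> B (c *: S + T)),
      (forall S T, B S -> B T -> B (S \o T)) /\ (forall T, B T -> B (adj T))
    & forall T, adjointable T ->
        (forall e : R, 0 < e ->
          exists2 S, B S & (opnorm fnorm fnorm (T - S)%R <= e%:E)%E) ->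
        B T].

Definition weight (p : rpath G) : R := (mu (src p) / mu (tgt p)) `^ (1 / 4).

Definition edge_weight d : R := (mu (dsrc d) / mu (dtgt d)) `^ (1 / 4).

Definition Xop d : fock -> fock :=
  (edge_weight d)%:C *: creation d +
  ((edge_weight d)^-1)%:C *: adj (creation (dop d)).

Definition free_graph_algebra : set (fock -> fock) :=
  smallest is_cstar_subalgebra (range lact `|` range Xop).

Definition cond_exp (x : fock -> fock) (w : vertex G) : C :=
  csum setT (fun v => ip (pvec v) (x (pvec v)) w).

(* Only meant for the domain of definition of the trace. *)
Definition Tr (x : fock -> fock) : C :=
  csum setT (fun v => (mu v)%:C * cond_exp x v).

Definition free_loop_algebra : set (fock -> fock) :=
  [set pv (base G) \o x \o pv (base G) | x in free_graph_algebra].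

(* The tracial state of the free loop algebra is the restriction of [Tr]. *)
Definition norm2 (x : fock -> fock) : R :=
  Num.sqrt (complex.Re (Tr (adj x \o x))).

Definition creation_path (p : rpath G) : fock -> fock :=
  if p.2 is [::] then pv p.1
  else foldr (fun d T => creation d \o T) id p.2.

Definition wick (p : rpath G) : fock -> fock :=
  \sum_(j < (len p).+1)
    let rho := (p.1, take j p.2) in
    let tau := (tgt rho, drop j p.2) in
    (weight rho * (weight tau)^-1)%:C *:
      (creation_path rho \o adj (creation_path (rpath_op tau))).

Definition base_loop (p : gpath G) : Prop :=
  src (val p) = base G /\ tgt (val p) = base G.

Definition W (n : nat) : set (fock -> fock) :=
  lspan [set wick (val p) | p in [set p | base_loop p /\ len (val p) = n]].

End Fock.

Arguments free_graph_algebra {R} G.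
Arguments free_loop_algebra {R} G.
Arguments W {R} G n.

Section GNS.
Context {R : realType} (G : wgraph R).
Local Notation C := R[i].
Local Notation op := (fock G -> fock G).

(* [H] with the inner product [dot] (linear in the first variable) is a
   Hilbert space, and is the GNS space of [S0] for the state [Tr]: [eta] is the
   canonical map from [S0] to its completion and [lmul] is left multiplication
   by [S0], extended by continuity.  The values of [eta] and [lmul] outside of
   [S0] are irrelevant.  These data are unique up to a unitary. *)
Record is_gns (S0 : set op) (H : completeNormedModType C)
    (dot : {dot H for Num.conj}) (eta : op -> H) (lmul : op -> H -> H) :
    Prop := IsGNS {
  gns_norm : forall xi : H, `|xi| ^+ 2 = dot xi xi;
  gns_linear : forall (c : C) x y, S0 x -> S0 y ->
    eta (c *: x + y) = c *: eta x + eta y;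
  gns_dot : forall x y, S0 x -> S0 y -> dot (eta x) (eta y) = Tr (adj y \o x);
  gns_dense : dense (eta @` S0);
  gns_lmul_linear : forall x, S0 x -> linear (lmul x);
  gns_lmul_continuous : forall x, S0 x -> continuous (lmul x);
  gns_lmul : forall x y, S0 x -> S0 y -> lmul x (eta y) = eta (x \o y)
}.

Definition hnorm (H : completeNormedModType C) (xi : H) : R :=
  complex.Re `|xi|.

(* The nearest point of [E], for a closed subspace [E]. *)
Definition orthoproj (H : completeNormedModType C) (dot : {dot H for Num.conj})
    (E : set H) (xi : H) : H :=
  xget 0 [set zeta | E zeta /\ forall w, E w -> dot (xi - zeta) w = 0].

End GNS.

(* Main.v *)
(* On [L^2(S_0)], a Wick word [Y_s] sends the basis vector of a loop [p] to the
   sum, over the splittings [s = r t] such that [p = t^op q], of the vectors of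
   [r q] with coefficient [mu(w)^(-1/2)], [w] being the target of [r]; this
   coefficient is at most [1] because [mu >= mu(v_0) = 1].  The lengths of [s],
   [p] and [r q] determine that of [r], so the block of [x] from level [n] to
   level [m] comes from a single splitting length.  It is then dominated
   entrywise by a matrix product indexed by [r], [t], [q], and the bound is the
   submultiplicativity of the Hilbert-Schmidt norm. *)
Require Import Defs.
From HB Require Import structures.
From mathcomp Require Import all_boot all_order all_algebra.
From mathcomp Require Import sesquilinear complex.
From mathcomp Require Import ring lra zify.
From mathcomp Require Import all_classical all_reals all_analysis.

Set Implicit Arguments.
Unset Strict Implicit.
Unset Printing Implicit Defensive.

Import Order.TTheory GRing.Theory Num.Theory.
Import numFieldNormedType.Exports.

Local Open Scope classical_set_scope.
Local Open Scope ring_scope.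
Local Open Scope complex_scope.

(** * Summable families *)

(** The GNS space is known only through its defining properties, so the estimate is moved to finite
    sums. Each projected vector is represented by a finite combination of Wick words, and applying
    it to the vertex vector of $v_0$ gives a finite family of amplitudes on words. The trace of
    $z^*x$ collapses to the base vertex and becomes the Euclidean inner product of amplitudes. The
    GNS properties speak only of elements of $\mathcal S_0$, so Wick words of loops must be shown to
    lie there; this comes from the recursion expressing $X_d Y_s$ through $Y_{ds}$ and a shorter
    Wick word.

    $P_m$ is never computed: for $z = P_m(xy)$ one has $\|z\|_2^2 = \langle xy, z\rangle$, so it is
    enough to bound this pairing by $\|z\|_2\|x\|_2\|y\|_2$. The sums run over all words in a finite
    alphabet of edges closed under reversal; coordinates are $0$ off the paths, so no composability
    condition has to be carried along. *)

Section Sums.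
Context {R : realType} {T : choiceType}.
Implicit Types (A : set T) (p q : T -> R) (f g : T -> R[i]).

Definition rsummable A p := summable A (EFin \o p).

Definition csummable A f := rsummable A (fun i => Normc.normc (f i)).

Lemma normc_ge0 (z : R[i]) : 0 <= Normc.normc z.
Proof. by case: z => x y; exact: sqrtr_ge0. Qed.

Lemma Re_le_normc (z : R[i]) : `|complex.Re z| <= Normc.normc z.
Proof.
by case: z => x y; rewrite -sqrtr_sqr; apply: ler_wsqrtr; rewrite lerDl sqr_ge0.
Qed.

Lemma Im_le_normc (z : R[i]) : `|complex.Im z| <= Normc.normc z.
Proof.
by case: z => x y; rewrite -sqrtr_sqr; apply: ler_wsqrtr; rewrite lerDr sqr_ge0.
Qed.

Lemma rsummable_le A p q : (forall i, A i -> `|p i| <= q i) ->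
  rsummable A q -> rsummable A p.
Proof.
move=> pq; apply: le_lt_trans; apply: le_esum => i Ai /=.
by rewrite lee_fin (le_trans (pq i Ai))// ler_norm.
Qed.

Lemma rsummableD A p q : rsummable A p -> rsummable A q ->
  rsummable A (fun i => p i + q i).
Proof. exact: summableD. Qed.

Lemma esumZl A (k : R) (h : T -> \bar R) : 0 <= k -> (forall i, 0 <= h i)%E ->
  (\esum_(i in A) (k%:E * h i) = k%:E * \esum_(i in A) h i)%E.
Proof.
move=> k0 h0; rewrite /esum -ereal_supZl//; last first.
  apply/set0P; exists (\sum_(x \in set0) h x)%E; exists set0 => //.
  exact: fsets_set0.
rewrite image_comp; congr ereal_sup; apply: eq_imagel => B _ /=.
by rewrite ge0_mule_fsumr.
Qed.

Lemma rsummableZ A (k : R) p : rsummable A p -> rsummable A (fun i => k * p i).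
Proof.
rewrite /rsummable !summableE => sp.
rewrite (_ : esum _ _ = `|k|%:E * \esum_(i in A) `|(p i)%:E|)%E.
  by rewrite fin_numM.
rewrite -esumZl//; apply: eq_esum => i _ /=.
by rewrite normrM EFinM.
Qed.

Lemma rsummable_fin A p : (forall i, 0 <= p i) -> rsummable A p ->
  \esum_(i in A) (p i)%:E \is a fin_num.
Proof.
move=> p0; rewrite /rsummable summableE; congr (_ \is a fin_num).
by apply: eq_esum => i _ /=; rewrite ger0_norm.
Qed.

Lemma eq_rsum A p q : (forall i, A i -> p i = q i) -> rsum A p = rsum A q.
Proof.
move=> pq; rewrite /rsum; congr (fine _ - fine _); apply: eq_esum => i Ai;
  by rewrite ?funeposE ?funenegE /= pq.
Qed.

(** [rsum] is defined through positive and negative parts, which are not additive. Any other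
    splitting into nonnegative summable families gives the same value, so linearity can be read off
    a convenient splitting. *)
Lemma rsumB_ge0 A p q : (forall i, 0 <= p i) -> (forall i, 0 <= q i) ->
    rsummable A p -> rsummable A q ->
  rsum A (fun i => p i - q i) =
  fine (\esum_(i in A) (p i)%:E) - fine (\esum_(i in A) (q i)%:E).
Proof.
move=> p0 q0 sp sq; have spq := summableB sp sq.
have pos_fin h : (forall i, 0 <= h i)%E -> summable A h ->
    esum A h \is a fin_num.
  move=> h0; rewrite summableE; congr (_ \is a fin_num).
  by apply: eq_esum => i _; rewrite gee0_abs.
rewrite /rsum -!fineB; first last.
- exact: pos_fin (summable_funeneg spq).
- exact: pos_fin (summable_funepos spq).
- exact: rsummable_fin.
- exact: rsummable_fin.
by congr fine; apply: (esumB sp sq) => i _; rewrite lee_fin.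
Qed.

Lemma rsumN A p : rsum A (fun i => - p i) = - rsum A p.
Proof.
rewrite /rsum opprB; congr (fine _ - fine _); apply: eq_esum => i _.
  by rewrite funeposE funenegE.
by rewrite funeposE funenegE /= opprK.
Qed.

Let pos p i := Num.max (p i) 0.

Let pos_sub p i : p i = pos p i - pos (\- p) i.
Proof. by rewrite /pos /=; case: (leP (p i) 0) => ?; case: (leP (- p i) 0) => ?; lra. Qed.

Let pos_ge0 p i : 0 <= pos p i.
Proof. by rewrite le_max lexx orbT. Qed.

Let pos_summable A p : rsummable A p -> rsummable A (pos p).
Proof.
have p0 i : `|pos p i| <= `|p i|.
  by rewrite ger0_norm ?pos_ge0// ge_max ler_norm normr_ge0.
rewrite /rsummable => sp; apply: le_lt_trans sp; apply: le_esum => i _.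
by rewrite /= lee_fin.
Qed.

Let rsummableN A p : rsummable A p -> rsummable A (\- p).
Proof.
move=> /(rsummableZ (-1)); rewrite (_ : (fun i => -1 * p i) = \- p)//.
by apply/funext => i; rewrite mulN1r.
Qed.

Let rsum_pos A p : rsummable A p -> rsum A p =
  fine (\esum_(i in A) (pos p i)%:E) - fine (\esum_(i in A) (pos (\- p) i)%:E).
Proof.
move=> sp; rewrite -rsumB_ge0; [|exact: pos_ge0|exact: pos_ge0|exact: pos_summable|].
  by apply: eq_rsum => i _; exact: pos_sub.
exact/pos_summable/rsummableN.
Qed.

Lemma rsumD A p q : rsummable A p -> rsummable A q ->
  rsum A (fun i => p i + q i) = rsum A p + rsum A q.
Proof.
move=> sp sq; have sNp := rsummableN sp; have sNq := rsummableN sq.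
have := @rsumB_ge0 A (fun i => pos p i + pos q i)
  (fun i => pos (\- p) i + pos (\- q) i).
rewrite (@eq_rsum _ _ (fun i => p i + q i)); last first.
  by move=> i _; rewrite (pos_sub p) (pos_sub q); ring.
move=> ->; try by [move=> i; rewrite addr_ge0 ?pos_ge0|
  apply: rsummableD; exact: pos_summable].
rewrite rsum_pos// rsum_pos//.
under eq_esum do rewrite EFinD.
rewrite esumD//; try by move=> i _; rewrite lee_fin pos_ge0.
under [X in _ - fine X]eq_esum do rewrite EFinD.
rewrite [X in _ - fine X]esumD//; try by move=> i _; rewrite lee_fin pos_ge0.
rewrite !fineD ?rsummable_fin//; try by [move=> i; exact: pos_ge0|
  exact: pos_summable].
ring.
Qed.

Let rsumZ_ge0 A (k : R) p : 0 <= k -> rsummable A p ->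
  rsum A (fun i => k * p i) = k * rsum A p.
Proof.
move=> k0 sp; have sNp := rsummableN sp.
have := @rsumB_ge0 A (fun i => k * pos p i) (fun i => k * pos (\- p) i).
rewrite (@eq_rsum _ _ (fun i => k * p i)); last first.
  by move=> i _; rewrite [in RHS](pos_sub p) mulrBr.
move=> ->; try by [move=> i; rewrite mulr_ge0 ?pos_ge0|
  apply: rsummableZ; exact: pos_summable].
under eq_esum do rewrite EFinM.
under [X in _ - fine X]eq_esum do rewrite EFinM.
rewrite !esumZl//; try by move=> i; rewrite lee_fin pos_ge0.
rewrite !fineM ?rsummable_fin//; try by [move=> i; exact: pos_ge0|
  exact: pos_summable].
by rewrite /= -mulrBr rsum_pos.
Qed.

Lemma rsumZ A (k : R) p : rsummable A p ->
  rsum A (fun i => k * p i) = k * rsum A p.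
Proof.
move=> sp; have [k0|/ltW k0] := leP 0 k; first exact: rsumZ_ge0.
rewrite -[RHS]opprK -mulNr -rsumZ_ge0 ?oppr_ge0// -rsumN.
by apply: eq_rsum => i _; rewrite mulNr opprK.
Qed.

Lemma rsum_set1 A t p : A t -> (forall i, i != t -> p i = 0) -> rsum A p = p t.
Proof.
move=> At p0; have one (h : T -> \bar R) : (forall i, 0 <= h i)%E ->
    (forall i, i != t -> h i = 0%E) -> \esum_(i in A) h i = h t.
  move=> h0 ht; rewrite (esumID [set t])// setI1 mem_set// esum_set1//.
  by rewrite esum1 ?adde0// => i [_ /eqP]; exact: ht.
rewrite /rsum !one//.
- by rewrite [in RHS](pos_sub p) funeposE funenegE /pos /= -!EFin_max.
- by move=> i it; rewrite funenegE /= p0// oppr0 maxxx.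
- by move=> i it; rewrite funeposE /= p0// maxxx.
Qed.

Lemma csummable_Re A f :
  csummable A f -> rsummable A (fun i => complex.Re (f i)).
Proof. by apply: rsummable_le => i _; exact: Re_le_normc. Qed.

Lemma csummable_Im A f :
  csummable A f -> rsummable A (fun i => complex.Im (f i)).
Proof. by apply: rsummable_le => i _; exact: Im_le_normc. Qed.

Lemma eq_csum A f g : (forall i, A i -> f i = g i) -> csum A f = csum A g.
Proof.
by move=> fg; rewrite /csum; congr (_ +i* _); apply: eq_rsum => i Ai; rewrite fg.
Qed.

Lemma csum_linear A (c : R[i]) f g : csummable A f -> csummable A g ->
  csum A (fun i => c * f i + g i) = c * csum A f + csum A g.
Proof.
move=> sf sg; have [sfR sfI] := (csummable_Re sf, csummable_Im sf).
have [sgR sgI] := (csummable_Re sg, csummable_Im sg).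
case: c => a b; rewrite /csum.
rewrite (@eq_rsum _ _ (fun i => (a * complex.Re (f i) + (- b) * complex.Im (f i))
    + complex.Re (g i))); last first.
  by move=> i _; case: (f i) (g i) => ? ? [? ?] /=; ring.
rewrite [X in _ +i* X](@eq_rsum _ _ (fun i => (a * complex.Im (f i)
    + b * complex.Re (f i)) + complex.Im (g i))); last first.
  by move=> i _; case: (f i) (g i) => ? ? [? ?] /=; ring.
have sZ (k : R) h : rsummable A h -> rsummable A (fun i => k * h i).
  exact: rsummableZ.
have sum3 (k l : R) h1 h2 h3 : rsummable A h1 -> rsummable A h2 ->
    rsummable A h3 -> rsum A (fun i => k * h1 i + l * h2 i + h3 i) =
    k * rsum A h1 + l * rsum A h2 + rsum A h3.
  move=> s1 s2 s3.
  rewrite (@rsumD A (fun i => k * h1 i + l * h2 i)); [|by apply: rsummableD; exact: sZ|by []].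
  by rewrite (@rsumD A (fun i => k * h1 i)) ?rsumZ//; exact: sZ.
rewrite !sum3//; apply/eqP; rewrite eq_complex /=; apply/andP; split; apply/eqP;
  ring.
Qed.

Lemma csum_conj A f : csum A (fun i => (f i)^*%R) = (csum A f)^*%R.
Proof.
rewrite -[RHS]/(csum A f)^*%C /csum /= -rsumN; congr (_ +i* _); apply: eq_rsum => i _;
  by case: (f i).
Qed.

Lemma csum_set1 A t f : A t -> (forall i, i != t -> f i = 0) -> csum A f = f t.
Proof.
move=> At f0; rewrite /csum !(rsum_set1 At)//; try by move=> i /f0 ->.
by case: (f t).
Qed.

Lemma csum0 A f : (forall i, A i -> f i = 0) -> csum A f = 0.
Proof.
move=> f0; rewrite /csum.
have s0 (h : T -> R) : (forall i, A i -> h i = 0) -> rsum A h = 0.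
  move=> h0; rewrite /rsum !esum1 ?subrr// => i Ai.
    by rewrite funenegE /= h0// oppr0 maxxx.
  by rewrite funeposE /= h0// maxxx.
by rewrite !s0// => i /f0 ->.
Qed.

End Sums.

Lemma csum_reindex (R : realType) (T T' : choiceType) (P : set T) (Q : set T')
    (e : T -> T') (f : T' -> R[i]) :
  set_bij P Q e -> csum Q f = csum P (f \o e).
Proof.
move=> Pe; have r0 (h : T' -> R) : rsum Q h = rsum P (h \o e).
  by rewrite /rsum; congr (fine _ - fine _);
    rewrite (reindex_esum _ _ e _ Pe); apply: eq_esum => i _;
    rewrite ?funeposE ?funenegE.
by rewrite /csum !r0.
Qed.

Lemma csum_subset (R : realType) (T : choiceType) (P Q : set T) (f : T -> R[i]) :
  Q `<=` P -> (forall i, P i -> ~ Q i -> f i = 0) -> csum P f = csum Q f.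
Proof.
move=> QP f0; have r0 (h : T -> R) : (forall i, P i -> ~ Q i -> h i = 0) ->
    rsum P h = rsum Q h.
  move=> h0; rewrite /rsum; congr (fine _ - fine _).
    rewrite -(setIidr QP) esum_mkcondr; apply: eq_esum => i Pi.
    case: ifPn => // /negP iQ; rewrite funeposE /= h0 ?maxxx//.
    by move=> Qi; apply: iQ; rewrite mem_set.
  rewrite -(setIidr QP) esum_mkcondr; apply: eq_esum => i Pi.
  case: ifPn => // /negP iQ; rewrite funenegE /= h0 ?oppr0 ?maxxx//.
  by move=> Qi; apply: iQ; rewrite mem_set.
by rewrite /csum !r0// => i Pi Qi; rewrite f0.
Qed.

(** * Coordinates and adjoints on the Fock space *)

Section FockSpace.
Context {R : realType} (G : wgraph R).
Local Notation C := R[i].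
Implicit Types (u v w : vertex G) (d : dedge G) (s t : seq (dedge G)).
Implicit Types (p q : gpath G) (f g h : fock G).

(* Coordinates indexed by arbitrary edge sequences, [0] off the paths, so that
   the operators below act on them without subtype bookkeeping. *)
Definition coord (f : gpath G -> C) v s : C :=
  if insub (v, s) : option (gpath G) is Some p then f p else 0.

Lemma coord_val (f : gpath G -> C) p : coord f (val p).1 (val p).2 = f p.
Proof. by rewrite /coord -surjective_pairing valK. Qed.

Lemma coord_path (f : gpath G -> C) v s (vs : is_walk v s) :
  coord f v s = f (exist _ (v, s) vs).
Proof. exact: (coord_val f (exist _ (v, s) vs)). Qed.

Lemma coord_nwalk (f : gpath G -> C) v s : ~~ is_walk v s -> coord f v s = 0.
Proof. by move=> vs; rewrite /coord insubN. Qed.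

Lemma fock_ext f g : (forall v s, coord f v s = coord g v s) -> f = g.
Proof.
move=> fg; apply/val_inj/funext => p.
by rewrite -[LHS]coord_val fg coord_val.
Qed.

Lemma coordD f g v s : coord (f + g) v s = coord f v s + coord g v s.
Proof. by rewrite /coord; case: insub => //; rewrite addr0. Qed.

Lemma coordZ (c : C) f v s : coord (c *: f) v s = c * coord f v s.
Proof. by rewrite /coord; case: insub => //; rewrite mulr0. Qed.

Lemma coord0 v s : coord (0 : fock G) v s = 0.
Proof. by rewrite /coord; case: insub. Qed.

Lemma coord_sum (I : Type) (r : seq I) (F : I -> fock G) v s :
  coord (\sum_(i <- r) F i) v s = \sum_(i <- r) coord (F i) v s.
Proof.
elim: r => [|i r IH]; first by rewrite !big_nil coord0.
by rewrite !big_cons coordD IH.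
Qed.

Lemma coord_pvec v u t : coord (pvec v) u t = ((u, t) == (v, [::]))%:R.
Proof.
have [ut|/negbTE ut] := boolP (is_walk u t); first by rewrite (coord_path _ ut).
rewrite coord_nwalk ?ut//; case: eqP => // -[_ tE].
by move: ut; rewrite tE.
Qed.

Lemma coord_creation d f u t : coord (creation d f) u t =
  if t is d' :: t' then ((d' == d) && (u == dsrc d))%:R * coord f (dtgt d) t'
  else 0.
Proof.
have [ut|] := boolP (is_walk u t); last first.
  move=> ut; rewrite coord_nwalk//; case: t ut => //= d' t.
  have [->|_] := eqVneq d' d; last by rewrite mul0r.
  rewrite eq_sym; case: eqVneq => //= _ dt; last by rewrite mul0r.
  by rewrite coord_nwalk ?mulr0.
case: t => [|d' t] in ut *; rewrite (coord_path _ ut)//=.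
rewrite -[f _]coord_val /=; case/andP: ut => /eqP ud _.
have [dd|dd] := eqVneq d' d; first by rewrite -ud dd !eqxx mul1r.
by rewrite mul0r; case: eqP => // -[] /eqP; rewrite (negbTE dd).
Qed.

Lemma coord_lact (a : c0 G) f u t : coord (lact a f) u t = a u * coord f u t.
Proof.
rewrite /coord; case: insubP => [p _ pE|_]; last by rewrite mulr0.
by rewrite -[u]/(u, t).1 -pE. Qed.

Lemma coord_pv v f u t : coord (pv v f) u t = (u == v)%:R * coord f u t.
Proof. by rewrite coord_lact. Qed.

Definition ends_at v : set (gpath G) := [set p | tgt (val p) = v].
Definition starts_with d : set (gpath G) := [set p | ohead (val p).2 == Some d].

(** The change of index that moves $\ell(d)$ across the inner product. *)
Lemma behead_bij d v : set_bij (ends_at v `&` starts_with d)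
  (ends_at v `&` [set p | src (val p) = dtgt d]) (@gpath_behead R G).
Proof.
split=> [p [] pv|p1 p2 /set_mem[_ /= /eqP D1] /set_mem[_ /= /eqP D2]|q [qv qd]].
- rewrite /starts_with /=; move: pv; case: p => -[w [|d' s]] //= pw pv /eqP[<-].
  by split.
- move=> /(congr1 val) /=.
  case: p1 p2 D1 D2 => -[v1 [|d1 s1]] w1 [[v2 [|d2 s2]] w2] //= [e1] [e2] [_ es].
  have /= /andP[/eqP v1E _] := w1; have /= /andP[/eqP v2E _] := w2.
  by apply/val_inj; rewrite /= -v1E -v2E e1 e2 es.
- have wq : is_walk (dsrc d) (d :: (val q).2).
    by rewrite /= eqxx -qd (valP q).
  exists (exist _ (dsrc d, d :: (val q).2) wq).
    split; [rewrite -qv /ends_at /= /tgt /= -qd//|by rewrite /starts_with /= eqxx].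
  by apply/val_inj; rewrite /= /rpath_behead /= -qd -surjective_pairing.
Qed.

Lemma sqnorm_summable f v :
  rsummable (ends_at v) (fun p => Normc.normc (f p) ^+ 2).
Proof.
have /in_fockP[/(_ v)] := fockP f; rewrite /rsummable summableE => fv _.
rewrite (_ : esum _ _ = sqnorm_at f v)//; apply: eq_esum => p _.
by rewrite /= ger0_norm ?sqr_ge0.
Qed.

Lemma normc_conj (z : C) : Normc.normc z^*%R = Normc.normc z.
Proof. by case: z => x y; rewrite -[_^*%R]/(x -i* y) /= sqrrN. Qed.

(** From $|ab| \le a^2 + b^2$. [csum] is linear only on absolutely summable families, so
    sesquilinearity of [ip] rests on this bound. *)
Lemma ip_summable f g v : csummable (ends_at v) (fun p => (f p)^*%R * g p).
Proof.
apply: rsummable_le (rsummableD (sqnorm_summable f v) (sqnorm_summable g v)).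
move=> p _; rewrite ger0_norm ?normc_ge0// Normc.normcM normc_conj.
have := sqr_ge0 (Normc.normc (f p) - Normc.normc (g p)).
have := sqr_ge0 (Normc.normc (f p)); have := sqr_ge0 (Normc.normc (g p)).
set a := Normc.normc (f p); set b := Normc.normc (g p); rewrite sqrrB; lra.
Qed.

Lemma ip_conj f g v : ip g f v = (ip f g v)^*%R.
Proof.
by rewrite /ip -csum_conj; apply: eq_csum => p _; rewrite rmorphM /= conjCK mulrC.
Qed.

Lemma ip_linearr (c : C) f g h v : ip f (c *: g + h) v = c * ip f g v + ip f h v.
Proof.
rewrite /ip -csum_linear; try exact: ip_summable.
by apply: eq_csum => p _; rewrite /= mulrDr mulrCA.
Qed.

Lemma ip_linearl (c : C) f g h v :
  ip (c *: f + g) h v = c^*%R * ip f h v + ip g h v.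
Proof. rewrite ip_conj ip_linearr rmorphD rmorphM /=.
by rewrite (ip_conj h f) (ip_conj h g). Qed.

Lemma ip0l f v : ip 0 f v = 0.
Proof.
rewrite /ip csum0// => p _.
rewrite -(coord_val (0 : fock G) p) coord0.
by rewrite conjC0 mul0r.
Qed.

(** The basis vector of the path [p], built with creation operators so that membership in the Fock
    space is automatic. *)
Definition delta p : fock G := foldr (@creation R G) (pvec (tgt (val p))) (val p).2.

Lemma coord_delta p u t : coord (delta p) u t = (val p == (u, t))%:R.
Proof.
rewrite /delta; case: p => -[v s] /=; elim: s v u t => [|d s IH] v u t vs /=.
  by rewrite coord_pvec eq_sym.
have /andP[/eqP sv ws] := vs; rewrite coord_creation.
case: t => [|d' t]; first by rewrite (_ : (_ == _) = false)//; apply/eqP => -[].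
rewrite (IH (dtgt d))// -natrM mulnb sv !xpair_eqE /= eqseq_cons eqxx /=.
rewrite [u == v]eq_sym [d' == d]eq_sym.
by case: (v == u); case: (d == d').
Qed.

Lemma ip_delta p g v : ip (delta p) g v = (tgt (val p) == v)%:R * g p.
Proof.
have deltaE q : delta p q = (p == q)%:R.
  by rewrite -coord_val coord_delta -surjective_pairing.
have [pv|pv] := eqVneq.
  rewrite /ip (csum_set1 (t := p))//; first by rewrite deltaE eqxx conjC1.
  by move=> q qp; rewrite deltaE eq_sym (negbTE qp) conjC0 mul0r.
rewrite mul0r /ip csum0// => q qv; rewrite deltaE; case: eqP; last first.
  by rewrite conjC0 mul0r.
by move=> pq; move: pv; rewrite pq qv eqxx.
Qed.

Lemma ip_inj g h : (forall f v, ip f g v = ip f h v) -> g = h.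
Proof.
move=> gh; apply/val_inj/funext => p.
by have := gh (delta p) (tgt (val p)); rewrite !ip_delta eqxx !mul1r.
Qed.

(** Nondegeneracy of [ip] makes adjoints unique, so the choice made in [adj] can be evaluated from
    any explicit candidate. *)
Lemma adjE (T T' : fock G -> fock G) : is_adjoint T T' -> adj T = T'.
Proof.
move=> TT; rewrite /adj; case: xgetP => [S _ TS|/(_ T')//].
by apply/funext => f; apply: ip_inj => g v; rewrite -TS TT.
Qed.

Lemma adjP (T : fock G -> fock G) : adjointable T -> is_adjoint T (adj T).
Proof. by move=> [T' TT]; rewrite (adjE TT). Qed.

Lemma is_adjointC (T T' : fock G -> fock G) : is_adjoint T T' -> is_adjoint T' T.
Proof. by move=> TT f g v; rewrite ip_conj -TT -ip_conj. Qed.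

Lemma is_adjoint_comp (S S' T T' : fock G -> fock G) :
  is_adjoint S S' -> is_adjoint T T' -> is_adjoint (S \o T) (T' \o S').
Proof. by move=> SS TT f g v /=; rewrite SS TT. Qed.

Lemma is_adjoint_linear (c : C) (S S' T T' : fock G -> fock G) :
    is_adjoint S S' -> is_adjoint T T' ->
  is_adjoint (c *: S + T) (c^*%R *: S' + T').
Proof.
move=> SS TT f g v.
by rewrite [LHS]ip_linearl [RHS]ip_linearr SS TT.
Qed.

(** The explicit form of $\ell(d)^*$: its coordinate at a path $q$ leaving the target of $d$ is the
    coordinate of $f$ at $dq$. *)
Definition annihilation_fun d f : gpath G -> C := fun p =>
  (src (val p) == dtgt d)%:R * coord f (dsrc d) (d :: (val p).2).

Lemma annihilation_behead d f p : starts_with d p ->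
  coord f (dsrc d) (d :: (val (gpath_behead p)).2) = f p.
Proof.
rewrite -[RHS]coord_val; case: p => -[v [|d' s]] //= vs /eqP[dd].
by rewrite -dd; case/andP: vs => /eqP ->.
Qed.

Fact annihilation_subproof d f : annihilation_fun d f \in @in_fock R G.
Proof.
apply/in_fockP; have /in_fockP := fockP f.
apply: (@vanishing_fin_le _ _ 1 _ (sqnorm_at f)) => //; try exact: sqnorm_at_ge0.
move=> v; rewrite mul1e.
rewrite (_ : sqnorm_at (annihilation_fun d f) v =
  \esum_(p in ends_at v `&` [set p | src (val p) = dtgt d])
    (Normc.normc (coord f (dsrc d) (d :: (val p).2)) ^+ 2)%:E); last first.
  rewrite esum_mkcondr; apply: eq_esum => p _; rewrite /annihilation_fun.
  case: eqP => pd; first by rewrite mem_set// mul1r.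
  by rewrite memNset// mul0r (_ : Normc.normc 0 = 0) ?expr0n//; exact: Normc.normc0.
rewrite (reindex_esum _ _ _ _ (behead_bij d v)).
under eq_esum => p [_ pd] do rewrite annihilation_behead//.
by apply: ereal_sup_le => _ [A [finA sA] <-]; exists A => //; split=> // p /sA[].
Qed.

Definition annihilation d f : fock G := Fock (annihilation_subproof d f).

Lemma coord_annihilation d f u t : coord (annihilation d f) u t =
  (u == dtgt d)%:R * coord f (dsrc d) (d :: t).
Proof.
have [ut|ut] := boolP (is_walk u t); first by rewrite (coord_path _ ut).
rewrite coord_nwalk//; case: eqP => [ud|_]; last by rewrite mul0r.
by rewrite coord_nwalk ?mulr0//= -ud negb_and ut orbT.
Qed.

Lemma creation_adjoint d : is_adjoint (creation d) (annihilation d).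
Proof.
move=> f g v; rewrite /ip.
rewrite (csum_subset (Q := ends_at v `&` starts_with d)); last 2 first.
- by move=> p [].
- move=> p pv npd; rewrite /=; case: ifPn => [pd|_]; first by case: npd.
  by rewrite conjC0 mul0r.
rewrite [RHS](csum_subset
    (Q := ends_at v `&` [set p | src (val p) = dtgt d])); last 2 first.
- by move=> p [].
- move=> p pv npd; rewrite /= /annihilation_fun; case: eqP => [pd|_].
    by case: npd.
  by rewrite mul0r mulr0.
rewrite (csum_reindex _ (behead_bij d v)); apply: eq_csum => p [pv pd].
have [_ bd] : (ends_at v `&` [set p | src (val p) = dtgt d]) (gpath_behead p).
  by case: (behead_bij d v) => + _ _; apply.
by rewrite /= /annihilation_fun bd eqxx mul1r annihilation_behead// pd.
Qed.

Lemma adj_creation d : adj (creation d) = annihilation d.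
Proof. exact/adjE/creation_adjoint. Qed.

Fact c0_conj_subproof (a : c0 G) : vanishing (fun v => (a v)^*%R).
Proof. by move=> e /(c0P a); under eq_set do rewrite -normc_conj. Qed.

Lemma lact_adjoint (a : c0 G) : is_adjoint (lact a) (lact (C0 (c0_conj_subproof a))).
Proof.
by move=> f g v; apply: eq_csum => p _; rewrite /= rmorphM mulrAC mulrC.
Qed.

Lemma pv_adjoint v : is_adjoint (pv v) (pv v).
Proof.
move=> f g w; apply: eq_csum => p _; rewrite /= rmorphM /= mulrAC mulrC.
by rewrite conjC_nat.
Qed.

Lemma coord_Xop d f u t : coord (Xop d f) u t =
  (edge_weight d)%:C * coord (creation d f) u t +
  ((edge_weight d)^-1)%:C * coord (annihilation (dop d) f) u t.
Proof. by rewrite /Xop adj_creation coordD !coordZ. Qed.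

(** * Adjointable operators and the free graph algebra *)

Lemma is_adjoint0 : is_adjoint (fun _ : fock G => 0) (fun=> 0).
Proof. by move=> f g v; rewrite ip0l ip_conj ip0l conjC0. Qed.

(** Makes the adjointable operators a competitor in the intersection defining [free_graph_algebra],
    so every element of that algebra has an adjoint. *)
Lemma adjointable_cstar : is_cstar_subalgebra (@adjointable R G).
Proof.
split=> //.
- exists (fun=> 0); exact: is_adjoint0.
- move=> c S T [S' SS] [T' TT]; exists (c^*%R *: S' + T').
  exact: is_adjoint_linear.
- split=> [S T [S' SS] [T' TT]|T /adjP /is_adjointC aT]; last by exists T.
  by exists (T' \o S'); exact: is_adjoint_comp.
Qed.

Lemma graph_algebra_adjointable (x : fock G -> fock G) :
  free_graph_algebra G x -> adjointable x.
Proof.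
apply; split; first exact: adjointable_cstar.
move=> T [[a _ <-]|[d _ <-]].
  by exists (lact (C0 (c0_conj_subproof a))); exact: lact_adjoint.
rewrite /Xop adj_creation; set b := (_^-1)%:C.
exists ((edge_weight d)%:C^*%R *: annihilation d +
        (b^*%R *: creation (dop d) + (fun=> 0))).
apply: is_adjoint_linear; first exact: creation_adjoint.
rewrite -[X in is_adjoint X]addr0.
apply: is_adjoint_linear is_adjoint0.
exact/is_adjointC/creation_adjoint.
Qed.

Lemma graph_algebra_cstar : is_cstar_subalgebra (free_graph_algebra G).
Proof.
split.
- exact: graph_algebra_adjointable.
- by move=> B [[]].
- move=> c S T SS TT B hB; have [[_ _ lB _ _] _] := hB.
  by apply: lB; [exact: SS|exact: TT].
- split=> [S T SS TT B hB|T TT B hB]; have [[_ _ _ [mB aB] _] _] := hB.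
    by apply: mB; [exact: SS|exact: TT].
  by apply: aB; exact: TT.
- move=> T aT closeT B hB; have [[_ _ _ _ cB] _] := hB.
  apply: cB => // e /closeT[S SS Se]; exists S => //; exact: SS.
Qed.

End FockSpace.

(** * Wick words *)

Section Wick.
Context {R : realType} (G : wgraph R).
Local Notation C := R[i].
Implicit Types (u v w : vertex G) (d : dedge G) (s t : seq (dedge G)).
Implicit Types (p q : gpath G) (f g h : fock G).

Lemma dopK : involutive (@dop R G).
Proof.
case=> -[e b] eb; apply/val_inj; rewrite /= /is_loop.
by move: eb; rewrite /= /is_loop; case: b => /=; case: (_ == _).
Qed.

Lemma dsrc_dop d : dsrc (dop d) = dtgt d.
Proof.
case: d => -[e b] /=; rewrite /dsrc /dtgt /= /is_loop.
by case: b => //=; case: eqP.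
Qed.

Lemma dtgt_dop d : dtgt (dop d) = dsrc d.
Proof. by rewrite -dsrc_dop dopK. Qed.

Definition rev_op s := rev (map (@dop R G) s).

Lemma rev_op_cons d s : rev_op (d :: s) = rcons (rev_op s) (dop d).
Proof. by rewrite /rev_op /= rev_cons. Qed.

Lemma size_rev_op s : size (rev_op s) = size s.
Proof. by rewrite size_rev size_map. Qed.

Lemma tgt_cons v d s : tgt (v, d :: s) = tgt (dtgt d, s). Proof. by []. Qed.

Lemma is_walk_cat v s t :
  is_walk v (s ++ t) = is_walk v s && is_walk (tgt (v, s)) t.
Proof. by elim: s v => //= d s IH v; rewrite IH andbA. Qed.

Lemma tgt_cat v s t : tgt (v, s ++ t) = tgt (tgt (v, s), t).
Proof. by rewrite /tgt /= map_cat last_cat. Qed.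

Lemma is_walk_rev_op v s : is_walk v s -> is_walk (tgt (v, s)) (rev_op s).
Proof.
elim: s v => //= d s IH v /andP[/eqP <- ws].
rewrite rev_op_cons -cats1 is_walk_cat tgt_cons IH//= dsrc_dop andbT.
have tgt_rev_op w : is_walk w s -> tgt (tgt (w, s), rev_op s) = w.
  elim: s w {IH ws} => //= d' s IH w /andP[/eqP <- ws].
  by rewrite rev_op_cons -cats1 tgt_cat [tgt (_, d' :: s)]tgt_cons IH// /tgt /= dtgt_dop.
by rewrite tgt_rev_op.
Qed.

Lemma weight_nil v : weight (v, [::] : seq (dedge G)) = 1.
Proof. by rewrite /weight divff ?powR1//; exact/lt0r_neq0/mu_gt0. Qed.

Lemma weight_gt0 (r : rpath G) : 0 < weight r.
Proof. by rewrite /weight powR_gt0// divr_gt0 ?mu_gt0. Qed.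

Lemma weight_cons d s :
  weight (dsrc d, d :: s) = edge_weight d * weight (dtgt d, s).
Proof.
rewrite /weight /edge_weight /src tgt_cons -powRM ?divr_ge0 ?ltW ?mu_gt0//.
by congr (_ `^ _); rewrite /= mulrA divfK//; exact/lt0r_neq0/mu_gt0.
Qed.

Lemma creation_pv d f : creation d (pv (dtgt d) f) = creation d f.
Proof.
apply: fock_ext => u [|d' t]; rewrite !coord_creation// coord_pv eqxx mul1r//.
Qed.

Lemma pv_creation d f : pv (dsrc d) (creation d f) = creation d f.
Proof.
apply: fock_ext => u [|d' t]; rewrite coord_pv !coord_creation ?mulr0// mulrA.
by case: (u == _); rewrite ?mul1r// andbF !mul0r.
Qed.

(** The product for a nonempty path ends in [id], while the path of length 0 gives [pv]. The
    recursion is still uniform because [creation d] absorbs the [pv] at its target. *)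
Lemma creation_path_cons v d s :
  creation_path (v, d :: s) = creation d \o creation_path (dtgt d, s).
Proof. by case: s => //=; apply/funext => f /=; rewrite creation_pv. Qed.

Lemma creation_path_rcons v s d : is_walk v (rcons s d) ->
  creation_path (v, rcons s d) = creation_path (v, s) \o creation d.
Proof.
elim: s v => [|d' s IH] v /andP[/eqP <- ws]; apply/funext => f.
  exact/esym/pv_creation.
by rewrite rcons_cons !creation_path_cons /= IH.
Qed.

Lemma coord_creation_path v s f u t : is_walk v s ->
  coord (creation_path (v, s) f) u t =
  ((u == v) && (take (size s) t == s))%:R * coord f (tgt (v, s)) (drop (size s) t).
Proof.
elim: s v u t => [|d s IH] v u t.
  by rewrite coord_pv take0 drop0 eqxx andbT; case: eqP => [->|_] //; rewrite !mul0r.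
move=> /andP[/eqP <- ws]; rewrite creation_path_cons /= coord_creation.
case: t => [|d' t]; first by rewrite andbF mul0r.
rewrite IH// mulrA -natrM mulnb eqxx /= eqseq_cons tgt_cons.
by case: (d' == d); case: (u == _).
Qed.

(** The reversed path ends with the reverse of the first edge of [s], so in the adjoint that edge is
    annihilated last. *)
Fixpoint annihilation_path v s : fock G -> fock G :=
  if s is d :: s' then annihilation (dop d) \o annihilation_path (dtgt d) s'
  else pv v.

Lemma annihilation_path_adjoint v s : is_walk v s ->
  is_adjoint (creation_path (rpath_op (v, s))) (annihilation_path v s).
Proof.
rewrite /rpath_op -/(rev_op s); elim: s v => [|d s IH] v.
  by move=> _; exact: pv_adjoint.
move=> vds; have := is_walk_rev_op vds; move: vds => /andP[/eqP vd ws].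
rewrite tgt_cons rev_op_cons => /creation_path_rcons ->.
by apply: is_adjoint_comp; [exact: IH|exact: creation_adjoint].
Qed.

Lemma coord_annihilation_path v s f u t : is_walk v s ->
  coord (annihilation_path v s f) u t =
  (u == v)%:R * coord f (tgt (v, s)) (rev_op s ++ t).
Proof.
elim: s v u t => [|d s IH] v u t.
  by rewrite coord_pv; case: eqP => [->|_] //; rewrite !mul0r.
move=> /andP[/eqP <- ws].
by rewrite coord_annihilation dtgt_dop dsrc_dop IH// eqxx mul1r rev_op_cons cat_rcons.
Qed.

Lemma coord_wick v s f u t : is_walk v s -> coord (wick (v, s) f) u t =
  \sum_(j < (size s).+1)
    (weight (v, take j s) * (weight (tgt (v, take j s), drop j s))^-1)%:C *
    (((u == v) && (take j t == take j s))%:R *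
     coord f (tgt (v, s)) (rev_op (drop j s) ++ drop j t)).
Proof.
move=> vs; rewrite /wick fct_sumE coord_sum; apply: eq_bigr => j _.
move: vs; rewrite -{1}(cat_take_drop j s) is_walk_cat => /andP[vt vd].
rewrite /= coordZ (adjE (annihilation_path_adjoint vd)) /=.
rewrite coord_creation_path// coord_annihilation_path// eqxx mul1r.
have js : (j <= size s)%N by rewrite -ltnS.
by rewrite (size_takel js) -[tgt (tgt _, _)]tgt_cat cat_take_drop.
Qed.

Lemma coord_wick_nil v f u t :
  coord (wick (v, [::]) f) u t = (u == v)%:R * coord f v t.
Proof.
rewrite coord_wick// big_ord1 /= weight_nil mul1r invr1 mul1r take0 drop0 eqxx.
by rewrite andbT.
Qed.

(** A factorization of $ds$ with nonempty left part is $d$ followed by a factorization of $s$: these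
    give the creation term. The factorization with empty left part gives the other term. *)
Lemma coord_wick_cons d s f u t : is_walk (dtgt d) s ->
  coord (wick (dsrc d, d :: s) f) u t =
  (edge_weight d)%:C * coord (creation d (wick (dtgt d, s) f)) u t +
  ((weight (dsrc d, d :: s))^-1)%:C *
    ((u == dsrc d)%:R * coord f (tgt (dtgt d, s)) (rev_op (d :: s) ++ t)).
Proof.
move=> ws; rewrite coord_wick/= ?eqxx// big_ord_recl addrC; congr (_ + _); last first.
  by rewrite /= weight_nil mul1r take0 drop0 eqxx andbT.
rewrite coord_creation; case: t => [|d' t].
  by rewrite mulr0 big1// => j _; rewrite /= andbF mul0r mulr0.
rewrite coord_wick// !big_distrr/=; apply: eq_bigr => j _.
rewrite /bump /= ?add1n /= weight_cons eqseq_cons eqxx /= tgt_cons.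
rewrite -[edge_weight d * _ * _]mulrA rmorphM /=.
rewrite -[LHS]mulrA; congr (_ * _).
rewrite [RHS]mulrCA; congr (_ * _); rewrite mulrA -natrM mulnb.
by case: (d' == d); case: (u == _).
Qed.

Lemma coord_wick_src v s f u t : is_walk v s -> u != v ->
  coord (wick (v, s) f) u t = 0.
Proof.
move=> vs /negbTE uv; rewrite coord_wick// big1// => j _.
by rewrite uv mul0r mulr0.
Qed.

(** The creation half of $X_d$ prolongs the left part of each factorization by $d$. The annihilation
    half supplies the purely annihilating term of $Y_{ds}$ and, when $s$ begins with $d^{op}$, also
    cancels that edge; the cancellation is the subtracted term. When $s$ is empty the coefficient is
    $0$. *)
Lemma Xop_wick d s : is_walk (dtgt d) s ->
  wick (dsrc d, d :: s) =
  (- (if s is d' :: _ then (d' == dop d)%:R *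
       ((edge_weight d)^-1 * edge_weight d')%:C else 0)) *:
    wick (dsrc d, behead s) + (Xop d \o wick (dtgt d, s)).
Proof.
move=> ws; apply/funext => f; apply: fock_ext => u t.
rewrite coord_wick_cons// [RHS]coordD coordZ coord_Xop.
rewrite [RHS]addrCA; congr (_ + _).
rewrite coord_annihilation dtgt_dop dsrc_dop weight_cons invfM rmorphM /=.
case: s ws => [|d' s] /= ws.
  rewrite oppr0 mul0r add0r coord_wick_nil eqxx mul1r weight_nil invr1 mulr1.
  by [].
case/andP: ws => /eqP sd' ws; rewrite -sd' coord_wick_cons// coord_creation sd'.
rewrite eqxx andbT mul1r (eq_sym _ d').
have -> : rev_op [:: d, d' & s] ++ t = rev_op (d' :: s) ++ dop d :: t.
  by rewrite rev_op_cons cat_rcons.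
rewrite tgt_cons rmorphM /=.
have [dd|_] := eqVneq d' (dop d); last first.
  by rewrite mul0r oppr0 !mul0r mulr0 !add0r; ring.
rewrite /= !mul1r -[dsrc d]dtgt_dop -dd.
have [->|ud] := eqVneq u (dtgt d'); first by rewrite /= !mul1r; ring.
by rewrite coord_wick_src//= mulr0 add0r !mul0r !mulr0.
Qed.

Lemma wick_in_graph_algebra v s : is_walk v s -> free_graph_algebra G (wick (v, s)).
Proof.
have [_ _ linS [mulS _] _] := graph_algebra_cstar G.
(* [Xop_wick] refers to words shorter by one and by two edges, hence induction on a bound for the
   length. *)
have [n] := ubnP (size s); elim: n => // n IH in v s *.
case: s => [|d s] /=; rewrite ltnS => sn.
  move=> _; have -> : wick (v, [::]) = pv v.
    apply/funext => f; apply: fock_ext => u t; rewrite coord_wick_nil coord_pv.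
    by case: eqP => [->|_] //; rewrite !mul0r.
  by move=> B [_ genB]; apply: genB; left; exists (c0_ind v).
case/andP=> /eqP <- ws; rewrite Xop_wick//.
case: s sn ws => [|d' s] sn ws.
  rewrite oppr0; apply: linS; first by apply: IH.
  apply: mulS; last exact: IH.
  by move=> B [_ genB]; apply: genB; right; exists d.
have XS : free_graph_algebra G (Xop d \o wick (dtgt d, d' :: s)).
  apply: mulS; last exact: IH.
  by move=> B [_ genB]; apply: genB; right; exists d.
(* Only for [d' = dop d] is the beheaded word guaranteed to be a path from [dsrc d]; otherwise its
   term is dropped before the induction hypothesis is invoked. *)
have [dd|_] := eqVneq d' (dop d); last first.
  by rewrite mul0r oppr0 scale0r add0r.
apply: linS => //; apply: IH; first exact: ltnW.
by rewrite -[dsrc d]dtgt_dop -dd; case/andP: ws.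
Qed.

End Wick.

(** * Finite sums over words *)

Section FiniteSums.
Context {R : realType}.

(** Lagrange's identity: the difference of the two sides is half the double sum of $(a_i b_j - a_j
    b_i)^2$. *)
Lemma sum_cauchy_schwarz (I : Type) (r : seq I) (a b : I -> R) :
  (\sum_(i <- r) a i * b i) ^+ 2 <=
  (\sum_(i <- r) a i ^+ 2) * (\sum_(i <- r) b i ^+ 2).
Proof.
have : 0 <= \sum_(i <- r) \sum_(j <- r) (a i * b j - a j * b i) ^+ 2.
  by apply: sumr_ge0 => i _; apply: sumr_ge0 => j _; exact: sqr_ge0.
have -> : \sum_(i <- r) \sum_(j <- r) (a i * b j - a j * b i) ^+ 2 =
  \sum_(i <- r) \sum_(j <- r) (a i ^+ 2 * b j ^+ 2) +
  \sum_(i <- r) \sum_(j <- r) (b i ^+ 2 * a j ^+ 2) -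
  \sum_(i <- r) \sum_(j <- r) ((a i * b i) * (a j * b j)) *+ 2.
  rewrite -big_split -sumrB /=; apply: eq_bigr => i _.
  rewrite -big_split -sumrB /=; apply: eq_bigr => j _; ring.
have big2 (f g : I -> R) : \sum_(i <- r) \sum_(j <- r) (f i * g j) =
    (\sum_(i <- r) f i) * (\sum_(j <- r) g j).
  by rewrite big_distrl; apply: eq_bigr => i _; rewrite big_distrr.
under [X in _ - X]eq_bigr do rewrite sumrMnl.
rewrite sumrMnl !big2 expr2; lra.
Qed.

(** Submultiplicativity in dual form: Cauchy-Schwarz over pairs $(i,l)$ against $z$, then over $j$
    inside each entry of the product $ab$. *)
Lemma sum_frobenius (I J L : Type) (ri : seq I) (rj : seq J) (rl : seq L)
    (a : I -> J -> R) (b : J -> L -> R) (z : I -> L -> R) :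
  (\sum_(i <- ri) \sum_(l <- rl) z i l * \sum_(j <- rj) a i j * b j l) ^+ 2 <=
  (\sum_(i <- ri) \sum_(l <- rl) z i l ^+ 2) *
  ((\sum_(i <- ri) \sum_(j <- rj) a i j ^+ 2) *
   (\sum_(j <- rj) \sum_(l <- rl) b j l ^+ 2)).
Proof.
have pairE (F : I -> L -> R) : \sum_(i <- ri) \sum_(l <- rl) F i l =
    \sum_(p <- [seq (i, l) | i <- ri, l <- rl]) F p.1 p.2.
  by rewrite big_allpairs_dep.
rewrite !pairE /=; apply: le_trans (sum_cauchy_schwarz _ _ _) _.
apply: ler_wpM2l; first by apply: sumr_ge0 => p _; exact: sqr_ge0.
rewrite -(pairE (fun i l => (\sum_(j <- rj) a i j * b j l) ^+ 2)) /=.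
rewrite big_distrl; apply: ler_sum => i _ /=.
rewrite [X in _ * X]exchange_big big_distrr; apply: ler_sum => l _ /=.
exact: sum_cauchy_schwarz.
Qed.

Lemma normc_sum (I : Type) (r : seq I) (F : I -> R[i]) :
  Normc.normc (\sum_(i <- r) F i) <= \sum_(i <- r) Normc.normc (F i).
Proof.
elim: r => [|i r IH]; first by rewrite !big_nil Normc.normc0.
by rewrite !big_cons (le_trans (le_normcD _ _))// lerD2l.
Qed.

Lemma mul_conj_normc (z : R[i]) : z^*%R * z = (Normc.normc z ^+ 2)%:C.
Proof.
by rewrite mulrC -normCK normc_def -rmorphXn; case: z.
Qed.

End FiniteSums.

(** * Words of fixed length over a finite alphabet *)

Section Words.
Context {T : eqType}.
Implicit Types (D s t : seq T).

(** All words, composable or not, so that cutting at a fixed length identifies the index set with a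
    product. *)
Fixpoint words D n : seq (seq T) :=
  if n is n'.+1 then [seq x :: s | x <- D, s <- words D n'] else [:: [::]].

Lemma mem_words D n s : (s \in words D n) = (size s == n) && all (mem D) s.
Proof.
elim: n s => [|n IH] [|x s] //=; first by apply/allpairsP => -[[? ?] []].
rewrite eqSS andbCA -IH; apply/allpairsP/andP => [[[y t] /= [yD tD [-> ->]]]|[xD sD]] //.
by exists (x, s).
Qed.

Lemma uniq_words D n : uniq D -> uniq (words D n).
Proof.
move=> uD; elim: n => //= n IH; apply: allpairs_uniq => //.
by move=> [x s] [y t] _ _ /= [-> ->].
Qed.

Lemma sum_words_cat (V : nmodType) D m n (F : seq T -> V) :
  \sum_(s <- words D (m + n)) F s =
  \sum_(s <- words D m) \sum_(t <- words D n) F (s ++ t).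
Proof.
elim: m F => [|m IH] F; first by rewrite big_seq1.
rewrite !big_allpairs_dep; apply: eq_bigr => x _.
by rewrite (IH (fun s => F (x :: s))).
Qed.

Lemma sum_words_delta (V : pzSemiRingType) D n s (F : seq T -> V) : uniq D ->
  s \in words D n -> \sum_(t <- words D n) (s == t)%:R * F t = F s.
Proof.
move=> uD sD; rewrite (bigD1_seq s) ?uniq_words//= eqxx mul1r big1 ?addr0// => t.
by rewrite eq_sym => /negbTE ->; rewrite mul0r.
Qed.

Lemma cat_eq_split n j (r s t : seq T) :
    (j <= n)%N -> size s = n -> size t = (n - j)%N ->
  (s == r ++ t) = (r == take j s) && (drop j s == t).
Proof.
move=> jn sn tn; apply/eqP/andP => [E|[/eqP -> /eqP <-]]; last first.
  by rewrite cat_take_drop.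
have rj : size r = j by move: (congr1 size E); rewrite size_cat sn tn; lia.
by rewrite E -rj take_size_cat// drop_size_cat// !eqxx.
Qed.

End Words.

(** * Action of Wick words on loops *)

Section Loops.
Context {R : realType} (G : wgraph R).
Local Notation C := R[i].
Local Notation b0 := (base G).
Local Notation vacuum := (pvec b0).
Implicit Types (u v w : vertex G) (d : dedge G) (r s t : seq (dedge G)).
Implicit Types (p q : gpath G) (f g h : fock G) (x y z : fock G -> fock G).
Implicit Types (D : seq (dedge G)).

Lemma gpathE p : val p = (src (val p), (val p).2).
Proof. exact: surjective_pairing. Qed.

Lemma base_loop_walk p : base_loop p -> is_walk b0 (val p).2.
Proof. by case=> <- _; exact: (valP p). Qed.

Lemma base_loop_tgt p : base_loop p -> tgt (b0, (val p).2) = b0.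
Proof. by case=> sp {2}<-; rewrite [in RHS]gpathE sp. Qed.

Lemma weight_loop v s : tgt (v, s) = v -> weight (v, s) = 1.
Proof.
by move=> tv; rewrite /weight tv divff ?powR1//; exact/lt0r_neq0/mu_gt0.
Qed.

(** Annihilators kill vertex vectors, so only the factorization with empty right part survives, and
    a loop has weight $1$. Thus Wick words of loops are recovered from their values at the
    vacuum. *)
Lemma wick_pvec p u : base_loop p ->
  wick (val p) (pvec u) = (u == b0)%:R *: delta p.
Proof.
move=> lp; have ws := base_loop_walk lp; have tp := base_loop_tgt lp.
apply: fock_ext => v t; rewrite coordZ coord_delta gpathE (proj1 lp).
set s := (val p).2 in ws tp *; rewrite coord_wick// tp.
rewrite big_ord_recr /= big1 => [|j _]; last first.
  rewrite coord_pvec xpair_eqE -[_ == [::]]size_eq0 size_cat size_rev_op size_drop.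
  by rewrite addn_eq0 subn_eq0 leqNgt ltn_ord andbF mulr0n !mulr0.
rewrite add0r take_size drop_size tp weight_nil invr1 mulr1 weight_loop// mul1r.
rewrite coord_pvec xpair_eqE -!natrM !mulnb; congr (nat_of_bool _)%:R.
rewrite xpair_eqE (eq_sym b0 u) (eq_sym b0 v); case: (v == b0) => /=; last by rewrite andbF.
case: (u == b0); rewrite /= ?andbF// -[drop _ t == _]size_eq0 size_drop subn_eq0.
apply/andP/eqP => [[/eqP ts tl]|->]; last by rewrite take_size leqnn eqxx.
by rewrite -ts take_oversize.
Qed.

Lemma pv_wick_pv p f : base_loop p ->
  pv b0 (wick (val p) (pv b0 f)) = wick (val p) f.
Proof.
move=> lp; have ws := base_loop_walk lp; have tp := base_loop_tgt lp.
apply: fock_ext => v t; rewrite coord_pv gpathE (proj1 lp) !coord_wick// mulr_sumr.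
apply: eq_bigr => j _; rewrite tp coord_pv eqxx mul1r.
by case: (v == b0); rewrite ?mul1r// mul0r mul0r mulr0.
Qed.

(** A version of [W] with the edges confined to the list [D], which makes all sums over loops
    finite. *)
Definition on_words D n x : Prop :=
  exists (N : nat) (c : 'I_N -> C) (q : 'I_N -> gpath G),
    [/\ forall i, base_loop (q i), forall i, (val (q i)).2 \in words D n
      & x = \sum_i c i *: wick (val (q i))].

(** Stated for every larger alphabet so that a single one can serve several elements at once. *)
Lemma W_on_words n x : W G n x ->
  exists D0, forall D, {subset D0 <= D} -> on_words D n x.
Proof.
move=> [N [c [u [uW ->]]]].
have /choice[q qP] : forall i, exists p : gpath G,
    (base_loop p /\ len (val p) = n) /\ wick (val p) = u i.
  by move=> i; have [p pP pu] := uW i; exists p.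
exists (flatten [seq (val (q i)).2 | i <- enum 'I_N]) => D D0D.
exists N, c, q; split=> [i|i|]; first by have [[]] := qP i.
  have [[_ lq] _] := qP i; rewrite mem_words -{1}lq eqxx; apply/allP => d dq.
  apply: D0D; apply/flattenP; exists (val (q i)).2 => //.
  by apply/mapP; exists i; rewrite ?mem_enum.
by apply: eq_bigr => i _; have [_ ->] := qP i.
Qed.

(** For [x] in the span of Wick words of loops, the coefficient of $Y_t$ in [x]. *)
Definition amp x t : C := coord (x vacuum) b0 t.

Lemma coord_comb (N : nat) (c : 'I_N -> C) (X : 'I_N -> fock G -> fock G) f v t :
  coord ((\sum_i c i *: X i) f) v t = \sum_i c i * coord (X i f) v t.
Proof.
by rewrite fct_sumE coord_sum; apply: eq_bigr => i _; rewrite -coordZ.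
Qed.

Lemma on_words_pvec D n x u : on_words D n x ->
  x (pvec u) = (u == b0)%:R *: x vacuum.
Proof.
case=> N [c [q [lq _ ->]]]; apply: fock_ext => v t.
rewrite coordZ !coord_comb mulr_sumr; apply: eq_bigr => i _.
by rewrite (wick_pvec u (lq i)) (wick_pvec b0 (lq i)) eqxx scale1r coordZ mulrCA.
Qed.

Lemma ip_sumr f (N : nat) (c : 'I_N -> C) (F : 'I_N -> fock G) v :
  ip f (\sum_i c i *: F i) v = \sum_i c i * ip f (F i) v.
Proof.
elim: N c F => [|N IH] c F.
  by rewrite !big_ord0 ip_conj ip0l conjC0.
by rewrite !big_ord_recl ip_linearr IH.
Qed.

Lemma on_words_comb D n x : on_words D n x ->
  exists (N : nat) (c : 'I_N -> C) (q : 'I_N -> gpath G),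
    [/\ forall i, base_loop (q i), forall i, (val (q i)).2 \in words D n,
        x vacuum = \sum_i c i *: delta (q i),
        (forall t, amp x t = \sum_i c i * ((val (q i)).2 == t)%:R)
      & x = \sum_i c i *: wick (val (q i))].
Proof.
case=> N [c [q [lq wq xE]]]; exists N, c, q.
have xv : x vacuum = \sum_i c i *: delta (q i).
  rewrite xE fct_sumE; apply: eq_bigr => i _.
  by rewrite -[LHS]/(c i *: wick (val (q i)) vacuum) wick_pvec// eqxx scale1r.
split=> // t; rewrite /amp xv coord_sum; apply: eq_bigr => i _.
rewrite coordZ coord_delta gpathE (proj1 (lq i)) xpair_eqE eqxx//.
Qed.

Lemma amp_out D n x t : on_words D n x -> t \notin words D n -> amp x t = 0.
Proof.
move=> /on_words_comb[N [c [q [_ wq _ -> _]]]] tD; apply: big1 => i _.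
by case: eqP => [qt|_]; [rewrite -qt wq in tD|rewrite mulr0].
Qed.

Lemma amp_nloop D n x t : on_words D n x -> tgt (b0, t) != b0 -> amp x t = 0.
Proof.
move=> /on_words_comb[N [c [q [lq _ _ -> _]]]] tD; apply: big1 => i _.
case: eqP => [qt|_]; last by rewrite mulr0.
by rewrite -qt (base_loop_tgt (lq i)) eqxx in tD.
Qed.

Lemma ip_on_words D n x g v : uniq D -> on_words D n x ->
  ip (x vacuum) g v =
  (v == b0)%:R * \sum_(t <- words D n) (amp x t)^*%R * coord g b0 t.
Proof.
move=> uD /on_words_comb[N [c [q [lq wq xv xE _]]]].
rewrite ip_conj xv ip_sumr rmorph_sum /=.
under eq_bigr => i _.
  rewrite rmorphM /= -ip_conj ip_delta (proj2 (lq i)) eq_sym mulrCA -coord_val.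
  rewrite (proj1 (lq i) : (val (q i)).1 = b0).
  over.
rewrite -mulr_sumr; congr (_ * _); under [RHS]eq_bigr do rewrite xE rmorph_sum mulr_suml.
rewrite exchange_big /=; apply: eq_bigr => i _.
rewrite -(sum_words_delta (fun t => coord g b0 t) uD (wq i)) mulr_sumr.
by apply: eq_bigr => t _; rewrite rmorphM /= conjC_nat mulrA.
Qed.

(** [z] kills every vertex vector except the vacuum, whose image is supported on paths ending at the
    base; both sums over vertices therefore reduce to the base, where $\mu = 1$. The operator [x] is
    arbitrary, so it may be a product. *)
Lemma Tr_on_words D n x z : mu b0 = 1 -> uniq D -> on_words D n z ->
    adjointable z ->
  Tr (adj z \o x) = \sum_(t <- words D n) (amp z t)^*%R * amp x t.
Proof.
move=> mub uD zD az; rewrite /Tr /cond_exp.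
have ipE u v : ip (pvec u) ((adj z \o x) (pvec u)) v = ip (z (pvec u)) (x (pvec u)) v.
  by rewrite (adjP az).
rewrite (csum_set1 (t := b0))// => [|v vb]; last first.
  rewrite csum0 ?mulr0// => u _; rewrite ipE (on_words_pvec _ zD).
  have [->|_] := eqVneq u b0; last by rewrite scale0r ip0l.
  by rewrite scale1r (ip_on_words _ _ uD zD) (negbTE vb) mul0r.
rewrite mub mul1r (csum_set1 (t := b0))// => [|u ub]; last first.
  by rewrite ipE (on_words_pvec _ zD) (negbTE ub) scale0r ip0l.
by rewrite ipE (ip_on_words _ _ uD zD) eqxx mul1r.
Qed.

(** The coefficient $a_r a_t^{-1}$ of the factorization $(r,t)$ in the Wick word of $rt$. *)
Definition kappa r t : R := weight (b0, r) * (weight (tgt (b0, r), t))^-1.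

Lemma kappa_ge0 r t : 0 <= kappa r t.
Proof. by rewrite mulr_ge0 ?invr_ge0// ltW ?weight_gt0. Qed.

(** The weights of $r$ and $t$ are the fourth roots of $\mu(v_0)/\mu(w)$ and of its inverse, where
    $w$ is the target of $r$. *)
Lemma kappa_le1 r t : (forall v, mu b0 <= mu v) -> tgt (b0, r ++ t) = b0 ->
  kappa r t <= 1.
Proof.
move=> mub; rewrite tgt_cat => tb; rewrite /kappa /weight tb /src /=.
set w := tgt (b0, r); have b0gt := mu_gt0 b0; have wgt := mu_gt0 w.
rewrite ler_pdivrMr ?mul1r ?powR_gt0 ?divr_gt0//.
have h4 : 0 <= 4^-1 :> R by rewrite invr_ge0.
apply: (ge0_ler_powR h4); try by rewrite nnegrE ltW ?divr_gt0.
by rewrite ler_pdivrMr// mulrAC ler_pdivlMr// -!expr2 ler_sqr ?nnegrE ?(ltW b0gt) ?(ltW wgt)//.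
Qed.

(** [kappa] may exceed $1$ when $rt$ is not a loop, but the amplitude vanishes there. *)
Lemma normc_amp_kappa D n x r t : (forall v, mu b0 <= mu v) -> on_words D n x ->
  Normc.normc (amp x (r ++ t) * (kappa r t)%:C) <= Normc.normc (amp x (r ++ t)).
Proof.
move=> mub xD; rewrite Normc.normcM.
have [tb|tb] := eqVneq (tgt (b0, r ++ t)) b0; last first.
  by rewrite (amp_nloop xD tb) Normc.normc0 mul0r.
rewrite ler_piMr ?normc_ge0//= expr0n addr0 sqrtr_sqr ger0_norm ?kappa_ge0//.
exact: kappa_le1.
Qed.

(** Summing over every possible annihilated part [s] makes the right side depend on [x] through its
    amplitudes alone. *)
Lemma coord_on_words D n x f t : uniq D -> on_words D n x ->
  coord (x f) b0 t = \sum_(j < n.+1) \sum_(s <- words D (n - j))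
    amp x (take j t ++ s) * (kappa (take j t) s)%:C *
    coord f b0 (rev_op s ++ drop j t).
Proof.
move=> uD /on_words_comb[N [c [q [lq wq xv xE xW]]]].
rewrite {1}xW coord_comb.
transitivity (\sum_(i < N) \sum_(j < n.+1) c i *
    ((take j t == take j (val (q i)).2)%:R *
    ((kappa (take j t) (drop j (val (q i)).2))%:C *
      coord f b0 (rev_op (drop j (val (q i)).2) ++ drop j t)))).
  apply: eq_bigr => i _; rewrite gpathE (proj1 (lq i)).
  rewrite coord_wick ?base_loop_walk// base_loop_tgt// mulr_sumr.
  have := wq i; rewrite mem_words => /andP[/eqP -> _].
  apply: eq_bigr => j _; congr (_ * _); rewrite eqxx /=.
  by case: eqP => [->|_]; rewrite /kappa ?mul1r// !mul0r mulr0.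
rewrite exchange_big; apply: eq_bigr => j _ /=.
under [RHS]eq_bigr do rewrite xE mulr_suml mulr_suml.
rewrite [RHS]exchange_big; apply: eq_bigr => i _ /=.
have := wq i; rewrite mem_words => /andP[/eqP sq qD].
have jn : (j <= n)%N by rewrite -ltnS.
have dq : drop j (val (q i)).2 \in words D (n - j).
  rewrite mem_words size_drop sq eqxx; apply/allP => d /mem_drop.
  by apply/allP.
(* The tail of the [i]-th loop is freed into a summation word by a Kronecker delta. The two
   comparisons, of heads and of tails, then merge into one comparison with [take j t ++ s]. *)
rewrite -(sum_words_delta (fun s => (kappa (take j t) s)%:C *
  coord f b0 (rev_op s ++ drop j t)) uD dq) !mulr_sumr.
rewrite big_seq_cond [RHS]big_seq_cond; apply: eq_bigr => s.
rewrite andbT mem_words => /andP[/eqP ss _]; rewrite (cat_eq_split _ jn sq ss).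
by rewrite -mulnb natrM !mulrA.
Qed.

Lemma perm_words_rev_op D n : uniq D -> {subset map (@dop R G) D <= D} ->
  perm_eq (map (@rev_op R G) (words D n)) (words D n).
Proof.
move=> uD cD; have rev_opK : involutive (@rev_op R G).
  by move=> s; rewrite /rev_op map_rev revK mapK//; exact: dopK.
have sD s : s \in words D n -> rev_op s \in words D n.
  rewrite !mem_words size_rev_op => /andP[-> /allP sD]; apply/allP => d.
  by rewrite mem_rev => /mapP[e /sD eD ->]; apply: cD; exact: map_f.
apply: uniq_perm; [|exact: uniq_words|].
  by rewrite map_inj_uniq ?uniq_words//; exact: inv_inj rev_opK.
move=> s; apply/mapP/idP => [[t tD ->]|/sD sD']; first exact: sD.
by exists (rev_op s); rewrite ?rev_opK.
Qed.

(** Reversal permutes the words over an alphabet closed under [dop], so reversing the row index [s]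
    does not change the Hilbert-Schmidt norm of the matrix $Y(st)$. *)
Lemma words_frobenius D (k m n : nat) (X Y Z : seq (dedge G) -> R) :
    uniq D -> {subset map (@dop R G) D <= D} ->
  (\sum_(r <- words D k) \sum_(t <- words D n) Z (r ++ t) *
     \sum_(s <- words D m) X (r ++ s) * Y (rev_op s ++ t)) ^+ 2 <=
  (\sum_(t <- words D (k + n)) Z t ^+ 2) *
  ((\sum_(t <- words D (k + m)) X t ^+ 2) *
   (\sum_(t <- words D (m + n)) Y t ^+ 2)).
Proof.
move=> uD cD; rewrite !sum_words_cat.
rewrite -(perm_big _ (perm_words_rev_op m uD cD)) big_map.
exact: sum_frobenius.
Qed.

Definition sqamp D n x : R := \sum_(t <- words D n) Normc.normc (amp x t) ^+ 2.

Lemma sqamp_ge0 D n x : 0 <= sqamp D n x.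
Proof. by apply: sumr_ge0 => t _; exact: sqr_ge0. Qed.

(** Pairing with [z] of level $m$ sees only the amplitudes of $xy$ on words of length $m$, so it
    replaces the projection to that level. *)
Lemma amp_comp_bound D k m n x y z : (forall v, mu b0 <= mu v) ->
    uniq D -> {subset map (@dop R G) D <= D} ->
    on_words D k x -> on_words D n y -> on_words D m z ->
  Normc.normc (\sum_(t <- words D m) (amp z t)^*%R * amp (x \o y) t) ^+ 2 <=
  sqamp D m z * (sqamp D k x * sqamp D n y).
Proof.
move=> mub uD cD xD yD zD.
(* The subtractions are truncated, so $j \le m$ must accompany the length equation; together they
   determine [j]. *)
have term0 (j : 'I_k.+1) t s : t \in words D m -> s \in words D (k - j) ->
    ~~ ((j <= m)%N && (k - j + (m - j) == n)%N) ->
    amp x (take j t ++ s) * (kappa (take j t) s)%:C *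
      amp y (rev_op s ++ drop j t) = 0.
  rewrite !mem_words => /andP[/eqP st _] /andP[/eqP ss _].
  have jk : (j <= k)%N by rewrite -ltnS.
  case: leqP => [jm|mj] /=.
    move=> H; rewrite [X in _ * X](amp_out yD) ?mulr0//.
    by rewrite mem_words size_cat size_rev_op size_drop st ss (negbTE H).
  (* For $j > m$, [take j t] is all of [t], and [take j t ++ s] has length $m + k - j < k$, outside
     the support of [amp x]. *)
  move=> _; rewrite (amp_out xD) ?mul0r// mem_words size_cat take_oversize ?st 1?ltnW//.
  by rewrite ss (_ : (_ == _) = false)//; apply/eqP; lia.
have ampE t : amp (x \o y) t = \sum_(j < k.+1) \sum_(s <- words D (k - j))
    amp x (take j t ++ s) * (kappa (take j t) s)%:C * amp y (rev_op s ++ drop j t).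
  by rewrite /amp /= (coord_on_words _ _ uD xD).
case: (pickP (fun j : 'I_k.+1 => (j <= m)%N && (k - j + (m - j) == n)%N)); last first.
  move=> nj; rewrite big_seq big1 => [|t tD].
    by rewrite Normc.normc0 expr0n !mulr_ge0 ?sqamp_ge0.
  rewrite ampE big1 ?mulr0// => j _; rewrite big_seq big1// => s sD.
  by rewrite term0// nj.
move=> j /andP[jm /eqP nE]; have jk : (j <= k)%N by rewrite -ltnS.
have {}ampE t : t \in words D m -> amp (x \o y) t = \sum_(s <- words D (k - j))
    amp x (take j t ++ s) * (kappa (take j t) s)%:C * amp y (rev_op s ++ drop j t).
  move=> tD; rewrite ampE (bigD1 j)//= [X in _ + X]big1 ?addr0// => i ij.
  rewrite big_seq big1// => s sD; apply: term0 => //; apply/negP => /andP[im /eqP iE].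
  case/eqP: ij; apply/val_inj => /=; have ik : (i <= k)%N by rewrite -ltnS.
  by move: iE nE => /=; lia.
have := words_frobenius j (k - j) (m - j) (fun t => Normc.normc (amp x t))
  (fun t => Normc.normc (amp y t)) (fun t => Normc.normc (amp z t)) uD cD.
rewrite (subnKC jm) (subnKC jk) nE; apply: le_trans.
rewrite ler_sqr ?nnegrE ?normc_ge0//; last first.
  apply: sumr_ge0 => r _; apply: sumr_ge0 => t _; rewrite mulr_ge0 ?normc_ge0//.
  by apply: sumr_ge0 => s _; rewrite mulr_ge0 ?normc_ge0.
have split_m (F : seq (dedge G) -> C) : \sum_(t <- words D m) F t =
    \sum_(r <- words D j) \sum_(t <- words D (m - j)) F (r ++ t).
  by rewrite -sum_words_cat subnKC.
rewrite split_m; apply: le_trans (normc_sum _ _) _.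
rewrite big_seq [leRHS]big_seq; apply: ler_sum => r rD.
apply: le_trans (normc_sum _ _) _.
rewrite big_seq [leRHS]big_seq; apply: ler_sum => t tD.
rewrite Normc.normcM normc_conj ler_wpM2l ?normc_ge0//.
have rj : size r = j by move: rD; rewrite mem_words => /andP[/eqP].
rewrite ampE; last first.
  move: rD tD; rewrite !mem_words => /andP[/eqP rs ra] /andP[/eqP ts ta].
  by rewrite size_cat rs ts subnKC// eqxx all_cat ra.
rewrite -{1 2 3}rj take_size_cat// drop_size_cat//.
apply: le_trans (normc_sum _ _) _; rewrite rj; apply: ler_sum => s _.
by rewrite Normc.normcM ler_wpM2r ?normc_ge0//; exact: normc_amp_kappa xD.
Qed.

End Loops.

(** * The free loop algebra and its GNS space *)

Section LoopAlgebra.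
Context {R : realType} (G : wgraph R).
Local Notation C := R[i].
Local Notation b0 := (base G).
Implicit Types (x y z : fock G -> fock G).

Lemma pv_linear v (c : C) (f g : fock G) : pv v (c *: f + g) = c *: pv v f + pv v g.
Proof.
by apply: fock_ext => u t; rewrite !(coord_pv, coordD, coordZ) mulrDr mulrCA.
Qed.

Lemma pv_idem v (f : fock G) : pv v (pv v f) = pv v f.
Proof.
by apply: fock_ext => u t; rewrite !coord_pv; case: (u == v); rewrite ?mul1r// !mul0r.
Qed.

Lemma pv_in_graph_algebra v : free_graph_algebra G (pv v).
Proof. by move=> B [_ genB]; apply: genB; left; exists (c0_ind v). Qed.

Lemma loop_algebra_graph x : free_loop_algebra G x -> free_graph_algebra G x.
Proof.
have [_ _ _ [mulS _] _] := graph_algebra_cstar G; have pS := pv_in_graph_algebra b0.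
by move=> [x' xS <-]; apply: (mulS) => //; exact: mulS.
Qed.

Lemma loop_algebra_adjointable x : free_loop_algebra G x -> adjointable x.
Proof. by move=> /loop_algebra_graph /graph_algebra_adjointable. Qed.

Lemma loop_algebra_linear (c : C) x y :
  free_loop_algebra G x -> free_loop_algebra G y -> free_loop_algebra G (c *: x + y).
Proof.
have [_ _ linS _ _] := graph_algebra_cstar G.
move=> [x' xS <-] [y' yS <-]; exists (c *: x' + y'); first exact: linS.
by apply/funext => f; exact: pv_linear.
Qed.

Lemma loop_algebra_comp x y :
  free_loop_algebra G x -> free_loop_algebra G y -> free_loop_algebra G (x \o y).
Proof.
have [_ _ _ [mulS _] _] := graph_algebra_cstar G; have pS := pv_in_graph_algebra b0.
move=> [x' xS <-] yS; exists (x' \o pv b0 \o y).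
  by apply: (mulS); [exact: mulS|exact: loop_algebra_graph].
case: yS => y' yS <-; apply/funext => f /=.
by rewrite !pv_idem.
Qed.

Lemma loop_algebra0 : free_loop_algebra G 0.
Proof.
have [_ S0 _ _ _] := graph_algebra_cstar G.
exists (fun=> 0) => //; apply/funext => f; apply: fock_ext => u t.
by rewrite coord_pv -[0 f]/(0 : fock G) !coord0 mulr0.
Qed.

Lemma W_loop_algebra n x : W G n x -> free_loop_algebra G x.
Proof.
move=> [N [c [u [uW ->]]]].
elim/big_ind: _ => [|y z yS zS|i _]; first exact: loop_algebra0.
  by rewrite -[y]scale1r; exact: loop_algebra_linear.
rewrite -[_ *: _]addr0; apply: loop_algebra_linear loop_algebra0.
have [p [lp _] <-] := uW i; exists (wick (val p)).
  by rewrite gpathE; apply: wick_in_graph_algebra; exact: (valP p).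
by apply/funext => f; exact: pv_wick_pv.
Qed.

Lemma W0 n : W G n 0.
Proof. by exists 0%N, (fun=> 0), (fun=> 0); split=> [[]|] //; rewrite big_ord0. Qed.

Lemma sqamp_Tr D n x : mu b0 = 1 -> uniq D -> on_words D n x -> adjointable x ->
  Tr (adj x \o x) = (sqamp D n x)%:C.
Proof.
move=> mub uD xD ax; rewrite (Tr_on_words _ mub uD xD ax) rmorph_sum.
by apply: eq_bigr => t _; exact: mul_conj_normc.
Qed.

End LoopAlgebra.

(** * Orthogonal projections in a Hilbert space *)

Section Projection.
Context {R : realType} {H : completeNormedModType R[i]}.
Variable dot : {dot H for Num.conj}.

(** When no vector satisfies the defining condition, [orthoproj] takes the default value $0$; both
    claims hold for it as well, because $0$ belongs to [E]. *)
Lemma orthoproj_spec (E : set H) (xi : H) : E 0 ->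
  E (orthoproj dot E xi) /\
  dot xi (orthoproj dot E xi) = dot (orthoproj dot E xi) (orthoproj dot E xi).
Proof.
move=> E0; rewrite /orthoproj; case: xgetP => [z _ [Ez orth]|_].
  split=> //; have := orth z Ez; rewrite linearBl => /eqP.
  by rewrite subr_eq0 => /eqP.
by split=> //; rewrite !linear0r.
Qed.

Lemma dot_orthoproj_le (E : set H) (xi : H) : E 0 ->
  dot (orthoproj dot E xi) (orthoproj dot E xi) <= dot xi xi.
Proof.
move=> /(orthoproj_spec xi)[_]; set z := orthoproj _ _ _ => xz.
have d0 : dot (xi - z) z = 0 by apply/eqP; rewrite linearBl subr_eq0; apply/eqP.
have /= := dnormD dot (xi - z) z; rewrite subrK d0 conjC0 !addr0 => ->.
by rewrite lerDr dnorm_ge0.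
Qed.

End Projection.

(** * The norm of the compressed left multiplication *)

Section Main.
Context {R : realType} (G : wgraph R) (hG : standing_assumptions G).
Context (H : completeNormedModType R[i]) (dot : {dot H for Num.conj}).
Context (eta : (fock G -> fock G) -> H) (lmul : (fock G -> fock G) -> H -> H).
Context (hH : is_gns (free_loop_algebra G) dot eta lmul).

Lemma gns_eta0 : eta 0 = 0.
Proof.
have := gns_linear hH (-1) (loop_algebra0 G) (loop_algebra0 G).
by rewrite scaler0 addr0 scaleN1r addNr.
Qed.

Lemma eta_W0 n : (eta @` W G n) 0.
Proof. by exists 0; [exact: W0|exact: gns_eta0]. Qed.

Lemma hnorm_dot (xi : H) (r : R) : dot xi xi = r%:C -> hnorm xi = Num.sqrt r.
Proof.
move=> xr; have : 0 <= `|xi| by exact: normr_ge0.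
rewrite /hnorm; have := gns_norm hH xi; rewrite xr.
case: `|xi| => a b ab; rewrite lecE /= => /andP[/eqP bE a0].
move: ab; rewrite bE expr2 => -[]; rewrite mulr0 subr0 => <- _.
by rewrite -expr2 sqrtr_sqr ger0_norm.
Qed.

Lemma hnorm_ge0 (xi : H) : 0 <= hnorm xi.
Proof. by have := normr_ge0 xi; rewrite /hnorm lecE => /andP[]. Qed.

Lemma dot_hnorm (xi : H) : dot xi xi = (hnorm xi ^+ 2)%:C.
Proof.
have := dnorm_ge0 dot xi; rewrite lecE => /andP[/eqP xi_im xi_re].
have xiE : dot xi xi = (complex.Re (dot xi xi))%:C.
  by rewrite [LHS]complexE xi_im mulr0 addr0.
by rewrite (hnorm_dot xiE) sqr_sqrtr.
Qed.

(** Provides a representative in [W G n], on which [lmul] is composition and [dot] is given by the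
    trace. *)
Lemma orthoproj_eta n (xi : H) : exists2 y, W G n y &
  orthoproj dot (eta @` W G n) xi = eta y /\ dot xi (eta y) = dot (eta y) (eta y).
Proof.
have [[y yW yE] yo] := orthoproj_spec dot xi (eta_W0 n).
by exists y; rewrite // yE.
Qed.

(** Let $y$ and $z$ represent the inner and the outer projection. Since $\langle xy, z\rangle =
    \|z\|_2^2$, the amplitude bound reads $\|z\|_2^4 \le \|z\|_2^2\,\|x\|_2^2\,\|y\|_2^2$, while
    $\|y\|_2 \le \|\xi\| \le 1$. *)
Lemma compression_bound m n k x (xi : H) : W G k x -> hnorm xi <= 1 ->
  hnorm (orthoproj dot (eta @` W G m)
    (lmul x (orthoproj dot (eta @` W G n) xi))) <= norm2 x.
Proof.
move=> xW xi1; have [_ _ mub mule _] := hG.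
have := dot_orthoproj_le dot xi (eta_W0 n).
have [y yW [-> _]] := orthoproj_eta n xi.
have [xS yS] := (W_loop_algebra xW, W_loop_algebra yW).
rewrite (gns_lmul hH)//.
have [z zW [-> zo]] := orthoproj_eta m (eta (x \o y)).
have zS := W_loop_algebra zW; have xyS := loop_algebra_comp xS yS.
have [Dx hDx] := W_on_words xW; have [Dy hDy] := W_on_words yW.
have [Dz hDz] := W_on_words zW.
(* One alphabet for all three elements, closed under reversal as [words_frobenius] demands. *)
pose D0 := Dx ++ Dy ++ Dz; pose D := undup (D0 ++ map (@dop R G) D0).
have uD : uniq D by exact: undup_uniq.
have cD : {subset map (@dop R G) D <= D}.
  move=> d /mapP[e + ->]; rewrite !mem_undup !(mem_cat _ D0).
  case/orP=> [eD|/mapP[e' eD ->]]; first by rewrite map_f ?orbT.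
  by rewrite dopK eD.
have xD : on_words D k x.
  by apply: hDx => d dx; rewrite mem_undup !mem_cat dx.
have yD : on_words D n y.
  by apply: hDy => d dy; rewrite mem_undup !mem_cat dy !orbT.
have zD : on_words D m z.
  by apply: hDz => d dz; rewrite mem_undup !mem_cat dz !orbT.
have adjS u : free_loop_algebra G u -> adjointable u.
  exact: loop_algebra_adjointable.
have sq l u : W G l u -> on_words D l u -> dot (eta u) (eta u) = (sqamp D l u)%:C.
  move=> /W_loop_algebra uS uD'.
  by rewrite (gns_dot hH)// (sqamp_Tr mub uD uD')//; exact: adjS.
rewrite (sq _ _ yW yD) (dot_hnorm xi) lecR => yxi.
rewrite (hnorm_dot (sq _ _ zW zD)) /norm2 (sqamp_Tr mub uD xD (adjS _ xS)) /=.
apply: ler_wsqrtr.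
have := amp_comp_bound mule uD cD xD yD zD.
rewrite -(Tr_on_words _ mub uD zD (adjS _ zS)) -(gns_dot hH)// zo (sq _ _ zW zD).
rewrite /= expr0n addr0 sqrtr_sqr real_normK ?num_real//.
have y1 : sqamp D n y <= 1.
  by rewrite (le_trans yxi)// expr_le1 ?hnorm_ge0.
(* The factor $\|z\|_2^2$ can be cancelled only when it is nonzero. *)
have [-> _|z0] := eqVneq (sqamp D m z) 0; first exact: sqamp_ge0.
rewrite expr2 ler_pM2l; last by rewrite lt_def z0 sqamp_ge0.
by move=> /le_trans; apply; rewrite ler_piMr ?sqamp_ge0.
Qed.

End Main.

Theorem lemma3p7 (R : realType) (G : wgraph R) (hG : standing_assumptions G)
    (H : completeNormedModType R[i]) (dot : {dot H for Num.conj})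
    (eta : (fock G -> fock G) -> H) (lmul : (fock G -> fock G) -> H -> H)
    (hH : is_gns (free_loop_algebra G) dot eta lmul)
    (m n k : nat) (x : fock G -> fock G) (hx : W G k x) :
  let P l := orthoproj dot (eta @` W G l) in
  (opnorm (@hnorm R H) (@hnorm R H)
    (P m \o lmul x \o P n) <= (norm2 x)%:E)%E.
Proof.
cbv zeta; apply: ge_ereal_sup => _ [xi /= xi1 <-].
by rewrite lee_fin; exact: (compression_bound hG hH m n hx xi1).
Qed.
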